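(* Let $s$ be an integer, let $M$ be a $3$-connected matroid, let $\mathcal{T}$ be a tangle of $M$ of order $\theta\geq 6$, let $N$ be a minor of $M$ with no loops and no coloops, and let $t:=\rank_{\mathcal{T}}(E(N))$. If $\theta\geq 2s+t+1$, then there are disjoint sets $C,D\subseteq E(M)\setminus E(N)$ such that $M/C\setminus D$ is $3$-connected with $N$ as a minor, such that $\rank_{\mathcal{T}}(E(N)\cup C\cup D)=t+|C\cup D|$, and such that $|C\cup D|\geq s$.
   Context: $\lambda_M(X) = \rank_M(X) + \rank_M(E(M)\setminus X) - \rank(M)$. A tangle of order $\theta$ of $M$ is a collection $\mathcal{T}$ of subsets of $E(M)$ such that: (i) $\lambda_M(X)<\theta$ for all $X\in\mathcal{T}$; (ii) for every $X\subseteq E(M)$ with $\lambda_M(X)<\theta$, either $X\in\mathcal{T}$ or $E(M)\setminus X\in\mathcal{T}$; (iii) if $X,Y,Z\in\mathcal{T}$ then $X\cup Y\cup Z\neq E(M)$; (iv) $E(M)\setminus\{e\}\notin\mathcal{T}$ for every $e\in E(M)$. $\rank_{\mathcal{T}}$ is the rank function of the tangle matroid: $\rank_{\mathcal{T}}(X) = \min\{\lambda_M(Y): X\subseteq Y\in\mathcal{T}\}$ if some member of $\mathcal{T}$ contains $X$, and $\rank_{\mathcal{T}}(X)=\theta$ otherwise. ''$M'$ has $N$ as a minor'' means $N$ itself (with labelled ground set) equals $M'/C'\setminus D'$ for some disjoint $C',D'\subseteq E(M')$. *)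

(* Defs.v *)
From mathcomp Require Import all_boot all_order all_algebra.
Set Implicit Arguments. Unset Strict Implicit. Unset Printing Implicit Defensive.

Record matroid (T : finType) := Matroid { ground : {set T}; rk : {set T} -> nat }.

Section Matroids.
Variable T : finType.
Implicit Types (M N : matroid T) (X Y Z C D : {set T}).

Definition matroid_axioms M : Prop :=
  [/\ forall X, X \subset ground M -> rk M X <= #|X|,
      forall X Y, X \subset Y -> Y \subset ground M -> rk M X <= rk M Y
    & forall X Y, X \subset ground M -> Y \subset ground M ->
        rk M (X :|: Y) + rk M (X :&: Y) <= rk M X + rk M Y].

Definition rank M := rk M (ground M).

Definition lambda M X := rk M X + rk M (ground M :\: X) - rank M.

Definition minor_of M C D : matroid T :=
  Matroid (ground M :\: (C :|: D)) (fun X => rk M (X :|: C) - rk M C).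

Definition matroid_eq M N : Prop :=
  ground M = ground N /\ forall X, X \subset ground M -> rk M X = rk N X.

Definition has_minor M N : Prop :=
  exists C D, [/\ C \subset ground M, D \subset ground M, [disjoint C & D]
                & matroid_eq N (minor_of M C D)].

Definition is_loop M e := (e \in ground M) && (rk M [set e] == 0).
Definition is_coloop M e := (e \in ground M) && (rk M (ground M :\ e) < rank M).
Definition no_loops M := forall e, ~~ is_loop M e.
Definition no_coloops M := forall e, ~~ is_coloop M e.

(* Tutte connectivity: a k-separation is a partition (X, E\X) with
   |X|, |E\X| >= k and lambda(X) < k; M is 3-connected if it has no
   k-separation for k < 3. *)
Definition three_connected M : Prop :=
  forall X k, X \subset ground M -> 0 < k < 3 ->
    k <= #|X| -> k <= #|ground M :\: X| -> k <= lambda M X.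

Definition is_tangle M (Tg : {set {set T}}) (theta : nat) : Prop :=
  [/\ forall X, X \in Tg -> X \subset ground M,
      forall X, X \in Tg -> lambda M X < theta,
      forall X, X \subset ground M -> lambda M X < theta ->
         (X \in Tg) \/ (ground M :\: X \in Tg),
      forall X Y Z, X \in Tg -> Y \in Tg -> Z \in Tg -> X :|: Y :|: Z != ground M
    & forall e, e \in ground M -> ground M :\ e \notin Tg].

(* rank function of the tangle matroid: min of lambda(Y) over members Y of
   the tangle containing X, and theta if there is none *)
Definition tangle_rank M (Tg : {set {set T}}) (theta : nat) X : nat :=
  \big[minn/theta]_(Y in Tg | X \subset Y) lambda M Y.

End Matroids.

(* Main.v *)
Require Import Defs.
From mathcomp Require Import all_boot all_order all_algebra.
From mathcomp Require Import zify.
Set Implicit Arguments. Unset Strict Implicit. Unset Printing Implicit Defensive.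
Import GRing.Theory Num.Theory.

(* The pair (C, D) is built one element at a time. Given a good pair with
   Z = C + D, pass to M/C\D with the tangle of order theta - |Z| induced on it;
   the T-closure F of E(N) + Z yields a member of the induced tangle, of
   connectivity at most t + |Z|, and it suffices to remove an element e outside
   a closed set containing F - Z so that 3-connectivity and N survive.

   Suppose no such e exists. Then every e outside F that can be deleted (or
   contracted) keeping N lies in the coguts (guts) of a 3-separation (A, E - A)
   with A in the tangle, and such an A meets F in at most one element. Uncrossing
   a smallest such A with at least three elements against the separations of its
   own elements produces a triangle and a triad with two common elements. Such a
   fan then grows without end: an end outside F whose removal keeps N is again
   stuck, which gives one more triangle or triad; the fan stays in the tangle, so
   it never exhausts E(M). Since the fan has at most one element in F, one of its
   two ends is always available.

   Rank and corank are carried by a boolean, which makes every argument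
   self-dual: [b = true] stands for rank, contraction, guts and triangles. *)

(* Pointwise decision of set identities and inclusions, using the inclusions
   and memberships in the context. *)
Ltac inst_subsets z :=
  repeat match goal with
  | H : is_true (?A \subset ?B) |- _ => move: (introT implyP (subsetP H z)); clear H
  end.
Ltac use_mems :=
  rewrite ?eqxx ?andbT ?andbF ?orbT ?orbF ?implybT //=;
  repeat match goal with
  | H : is_true (?x \in ?A) |- context [?x \in ?A] => rewrite H //=
  | H : is_true (?x \notin ?A) |- context [?x \in ?A] => rewrite (negbTE H) //=
  | H : is_true (?x != ?y) |- context [?x == ?y] => rewrite (negbTE H) //=
  | H : is_true (?x != ?y) |- context [?y == ?x] => rewrite [y == x]eq_sym (negbTE H) //=
  end.
Ltac case_point z :=
  repeat match goal with
  | |- context [z == ?x] => case: (eqVneq z x) => [->|?] //=; use_mems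
  end.
Ltac case_atoms :=
  repeat (use_mems; match goal with
  | |- context [?x == ?y] => case: (eqVneq x y) => [?|?]; [subst|]; rewrite ?eqxx //=
  | |- context [?x \in ?A] => case: (x \in A) => //=
  end).
Ltac set_tac :=
  let z := fresh "z" in
  match goal with
  | |- is_true (_ \subset _) => apply/subsetP => z; apply/implyP
  | |- _ => apply/setP => z
  end; inst_subsets z; rewrite ?inE; case_point z; case_atoms.

(* [lia] with the non-arithmetical part of the context removed. *)
Ltac nlia :=
  repeat match goal with
  | H : is_true ?P |- _ => lazymatch P with
    | (_ <= _)%N => fail
    | _ => clear H
    end
  | H : reflect _ _ |- _ => clear H
  end; lia.

(** * Rank, corank and connectivity *)

Section Basics.
Variables (T : finType) (M : matroid T).
Hypothesis hM : matroid_axioms M.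
Local Notation E := (ground M).
Implicit Types (X Y Z A B S : {set T}) (e x y : T) (b : bool).

Lemma rk_card X : X \subset E -> rk M X <= #|X|.
Proof. by case: hM => h _ _; apply: h. Qed.

Lemma rk_mono X Y : X \subset Y -> Y \subset E -> rk M X <= rk M Y.
Proof. by case: hM => _ h _; apply: h. Qed.

Lemma rk_submod X Y : X \subset E -> Y \subset E ->
  rk M (X :|: Y) + rk M (X :&: Y) <= rk M X + rk M Y.
Proof. by case: hM => _ _ h; apply: h. Qed.

Lemma rk_setU X Y : X \subset E -> Y \subset E -> rk M (X :|: Y) <= rk M X + #|Y|.
Proof. by move=> hX hY; have := rk_submod hX hY; have := rk_card hY; lia. Qed.

Lemma rk0 : rk M set0 = 0.
Proof. by have := rk_card (sub0set E); rewrite cards0; lia. Qed.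

(* The rank function for [b = true], the corank function for [b = false]. *)
Definition rkb b X :=
  if b then rk M (X :&: E) else #|X :&: E| + rk M (E :\: X) - rank M.

(** Makes the truncated subtraction in [rkb false] exact. *)
Lemma rank_le_corank X : rank M <= #|X :&: E| + rk M (E :\: X).
Proof.
have h : E = (E :\: X) :|: (X :&: E) by set_tac.
rewrite /rank [in rk M E]h.
have := @rk_setU (E :\: X) (X :&: E) (subsetDl _ _) (subsetIr _ _); lia.
Qed.

Lemma rkb_card b X : rkb b X <= #|X|.
Proof.
have hc := subset_leq_card (subsetIl X E).
case: b; rewrite /rkb.
  exact: leq_trans (rk_card (subsetIr _ _)) hc.
have := rk_mono (subsetDl E X) (subxx _); rewrite /rank; lia.
Qed.

Lemma rkb_mono b X Y : X \subset Y -> rkb b X <= rkb b Y.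
Proof.
move=> h; case: b; rewrite /rkb; first by apply: rk_mono (setSI _ h) (subsetIr _ _).
have e1 : E :\: X = (E :\: Y) :|: ((Y :\: X) :&: E) by set_tac.
have := @rk_setU (E :\: Y) ((Y :\: X) :&: E) (subsetDl _ _) (subsetIr _ _).
rewrite -e1 => h1.
have e2 : Y :&: E = (X :&: E) :|: ((Y :\: X) :&: E) by set_tac.
have e3 : [disjoint X :&: E & (Y :\: X) :&: E].
  by rewrite -setI_eq0; apply/eqP; set_tac.
have := leq_card_setU (X :&: E) ((Y :\: X) :&: E); rewrite e3 -e2 => -[_ /eqP]; lia.
Qed.

Lemma rkb_submod b X Y : rkb b (X :|: Y) + rkb b (X :&: Y) <= rkb b X + rkb b Y.
Proof.
case: b; rewrite /rkb.
  have := @rk_submod (X :&: E) (Y :&: E) (subsetIr _ _) (subsetIr _ _).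
  have -> : (X :&: E) :|: (Y :&: E) = (X :|: Y) :&: E by set_tac.
  by have -> : (X :&: E) :&: (Y :&: E) = (X :&: Y) :&: E by set_tac.
have := @rk_submod (E :\: X) (E :\: Y) (subsetDl _ _) (subsetDl _ _).
have -> : (E :\: X) :|: (E :\: Y) = E :\: (X :&: Y) by set_tac.
have -> : (E :\: X) :&: (E :\: Y) = E :\: (X :|: Y) by set_tac.
have := cardsUI (X :&: E) (Y :&: E).
have -> : (X :&: E) :|: (Y :&: E) = (X :|: Y) :&: E by set_tac.
have -> : (X :&: E) :&: (Y :&: E) = (X :&: Y) :&: E by set_tac.
have := rank_le_corank X; have := rank_le_corank Y.
have := rank_le_corank (X :|: Y); have := rank_le_corank (X :&: Y); lia.
Qed.

(** Avoids subtraction and holds for rank and corank alike, since connectivity is self-dual. *)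
Lemma lambdaE b X : X \subset E ->
  lambda M X + rkb b E = rkb b X + rkb b (E :\: X).
Proof.
move=> hX.
have h0 := @rk_submod X (E :\: X) hX (subsetDl _ _).
have eU : X :|: (E :\: X) = E by set_tac.
have eI : X :&: (E :\: X) = set0 by set_tac.
rewrite eU eI rk0 in h0.
have eX : X :&: E = X by set_tac.
have eD : (E :\: X) :&: E = E :\: X by set_tac.
have eDD : E :\: (E :\: X) = X by set_tac.
case: b; rewrite /rkb /lambda /rank ?eX ?eD ?eDD ?setIid ?setDv ?rk0.
  lia.
have := cardsID X E; rewrite setIC eX.
have := rank_le_corank X; rewrite /rank eX.
have := rank_le_corank (E :\: X); rewrite /rank eD eDD.
have := rk_mono hX (subxx _); have := rk_mono (subsetDl E X) (subxx _).
have := rk_card (subxx E); lia.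
Qed.

Lemma rkb_dual b X : X \subset E ->
  rkb (~~ b) X + rkb b E = #|X| + rkb b (E :\: X).
Proof.
move=> hX.
have eX : X :&: E = X by set_tac.
have eD : (E :\: X) :&: E = E :\: X by set_tac.
have eDD : E :\: (E :\: X) = X by set_tac.
case: b; rewrite /rkb /rank /= ?eX ?eD ?eDD ?setIid ?setDv ?rk0.
  have := rank_le_corank X; rewrite /rank eX; lia.
have := cardsID X E; rewrite setIC eX.
have := rank_le_corank (E :\: X); rewrite /rank eD eDD.
have := rk_mono hX (subxx _); have := rk_card (subxx E); lia.
Qed.

Lemma lambda_card b X : X \subset E ->
  lambda M X + #|X| = rkb b X + rkb (~~ b) X.
Proof.
move=> hX; have := lambdaE b hX; have := rkb_dual b hX.
have := rkb_mono b hX; lia.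
Qed.

Lemma lambdaC X : X \subset E -> lambda M (E :\: X) = lambda M X.
Proof.
move=> hX; have eDD : E :\: (E :\: X) = X by set_tac.
have := lambdaE true hX; have := lambdaE true (subsetDl E X); rewrite eDD; lia.
Qed.

Lemma lambda_submod X Y : X \subset E -> Y \subset E ->
  lambda M (X :|: Y) + lambda M (X :&: Y) <= lambda M X + lambda M Y.
Proof.
move=> hX hY.
have hU : X :|: Y \subset E by set_tac.
have hI : X :&: Y \subset E by set_tac.
have := lambdaE true hX; have := lambdaE true hY; have := lambdaE true hU.
have := lambdaE true hI; have := rkb_submod true X Y.
have := rkb_submod true (E :\: X) (E :\: Y).
have -> : (E :\: X) :|: (E :\: Y) = E :\: (X :&: Y) by set_tac.
have -> : (E :\: X) :&: (E :\: Y) = E :\: (X :|: Y) by set_tac.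
lia.
Qed.

Lemma lambda_leq_card X : X \subset E -> lambda M X <= #|X|.
Proof.
move=> hX; have := lambda_card true hX.
have := rkb_card true X; have := rkb_card (~~ true) X; lia.
Qed.

Lemma rkbU1 b e X : rkb b (e |: X) <= rkb b X + 1.
Proof.
have := rkb_submod b [set e] X; have := rkb_card b [set e]; rewrite cards1; lia.
Qed.

(** For [e] in the ground set: membership in the closure of [X] if [b] is true, in the coclosure if
    [b] is false. *)
Definition in_cl b X e := rkb b (e |: X) == rkb b X.

Lemma in_cl_mono b X Y e : X \subset Y -> in_cl b X e -> in_cl b Y e.
Proof.
move=> h /eqP c; have := rkb_submod b (e |: X) Y; have := rkb_mono b (subsetU1 e Y).
have -> : (e |: X) :|: Y = e |: Y by set_tac.
have := rkb_mono b (_ : X \subset (e |: X) :&: Y).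
have hs : X \subset (e |: X) :&: Y by set_tac.
move=> /(_ hs); rewrite /in_cl c => *; apply/eqP; lia.
Qed.

(** Orthogonality. Take [b = true]: the complement of Y + e contains X and so spans e. Passing from
    Y to Y + e then keeps the rank of the complement, which forces the corank up by one. *)
Lemma in_cl_orth b e X Y : e \in E -> X \subset E -> Y \subset E ->
  e \notin X -> e \notin Y -> X \subset ~: Y ->
  in_cl b X e -> in_cl (~~ b) Y e -> False.
Proof.
move=> he hX hY eX eY dXY cX /eqP cY.
have hs : X \subset E :\: (e |: Y) by set_tac.
have /eqP := in_cl_mono hs cX.
have -> : e |: (E :\: (e |: Y)) = E :\: Y by set_tac.
have hYe : e |: Y \subset E by set_tac.
have := rkb_dual b hY; have := rkb_dual b hYe.
rewrite cardsU1 eY cY; lia.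
Qed.

Lemma lambda_cl b e X : e \in E -> X \subset E -> e \notin X -> in_cl b X e ->
  lambda M (e |: X) <= lambda M X.
Proof.
move=> he hX eX /eqP c; have hXe : e |: X \subset E by set_tac.
have := lambda_card b hX; have := lambda_card b hXe.
rewrite cardsU1 eX c; have := rkbU1 (~~ b) e X; lia.
Qed.

(** By [lambda_card]: the size grows by one while neither rank nor corank does. Most contradictions
    below come from this drop. *)
Lemma lambda_cl2 b e X : e \in E -> X \subset E -> e \notin X ->
  in_cl b X e -> in_cl (~~ b) X e -> lambda M X = (lambda M (e |: X)).+1.
Proof.
move=> he hX eX /eqP c /eqP c'; have hXe : e |: X \subset E by set_tac.
have := lambda_card b hX; have := lambda_card b hXe.
rewrite cardsU1 eX c c'; lia.
Qed.

End Basics.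

Arguments rkb : simpl never.

(** * Tangles *)

Section Tangles.
Variables (T : finType) (M : matroid T) (Tg : {set {set T}}) (th : nat).
Hypotheses (hM : matroid_axioms M) (hT : is_tangle M Tg th).
Local Notation E := (ground M).
Local Notation lam := (lambda M).
Implicit Types (X Y Z A B S : {set T}) (e x y : T).

Lemma tangle_sub X : X \in Tg -> X \subset E.
Proof. by case: hT => h *; apply: h. Qed.

Lemma tangle_lt X : X \in Tg -> lam X < th.
Proof. by case: hT => _ h *; apply: h. Qed.

Lemma tangle_cover X Y Z :
  X \in Tg -> Y \in Tg -> Z \in Tg -> E \subset X :|: Y :|: Z -> False.
Proof.
move=> hX hY hZ hE; case: hT => _ _ _ /(_ X Y Z hX hY hZ) + _.
have sX := tangle_sub hX; have sY := tangle_sub hY; have sZ := tangle_sub hZ.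
by rewrite eqEsubset hE andbT => /negP; apply; set_tac.
Qed.

Lemma tangle_orC X : X \subset E -> lam X < th -> X \in Tg \/ E :\: X \in Tg.
Proof. by case: hT => _ _ h *; apply: h. Qed.

(** Otherwise the complement of [X] is a member, and together with [Y] it covers the ground set. *)
Lemma tangle_subset X Y : X \subset Y -> Y \in Tg -> lam X < th -> X \in Tg.
Proof.
move=> h hY lX; have sY := tangle_sub hY.
case: (tangle_orC (subset_trans h sY) lX) => // hc.
by case: (tangle_cover hY hc hc); set_tac.
Qed.

Lemma tangle_setU X Y : X \in Tg -> Y \in Tg -> lam (X :|: Y) < th -> X :|: Y \in Tg.
Proof.
move=> hX hY lXY; have sX := tangle_sub hX; have sY := tangle_sub hY.
have sU : X :|: Y \subset E by set_tac.
case: (tangle_orC sU lXY) => // hc.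
by case: (tangle_cover hX hY hc); set_tac.
Qed.

Lemma tangle_set1 e : 1 < th -> e \in E -> [set e] \in Tg.
Proof.
move=> th1 he; have sE : [set e] \subset E by rewrite sub1set.
case: (tangle_orC sE) => //.
  by have := lambda_leq_card hM sE; rewrite cards1; nlia.
by case: hT => _ _ _ _ /(_ e he) /negbTE ->.
Qed.

Lemma tangle_setU1 e X : 1 < th -> e \in E -> X \in Tg -> lam (e |: X) < th ->
  e |: X \in Tg.
Proof. by move=> th1 he; apply: tangle_setU; apply: tangle_set1. Qed.

(** Points are added one at a time to the empty set; each set on the way has connectivity at most
    its size. *)
Lemma tangle_small X : 1 < th -> X \subset E -> #|X| < th -> X \in Tg.
Proof.
move=> th1; elim: {X}_.+1 {-2}X (ltnSn #|X|) => // n IH X hn sX cX.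
have [->|[x hx]] := set_0Vmem X.
  have l0 : lam set0 < th by have := lambda_leq_card hM (sub0set E); rewrite cards0; nlia.
  case: (tangle_orC (sub0set E) l0) => //; rewrite setD0 => hE.
  by case: (tangle_cover hE hE hE); set_tac.
have eX := setD1K hx; have := cardsD1 x X; rewrite hx => cD.
have sD : X :\ x \subset E by set_tac.
rewrite -eX; apply: tangle_setU1 => //; first by apply: (subsetP sX).
  by apply: IH => //; nlia.
by rewrite eX; have := lambda_leq_card hM sX; nlia.
Qed.

Lemma tangle_compl X : 2 < th -> X \in Tg -> 2 < #|E :\: X|.
Proof.
move=> th2 hX; case: ltnP => // hc; exfalso.
have hD : E :\: X \in Tg by apply: tangle_small; [nlia| apply: subsetDl | nlia].
by apply: (tangle_cover hX hD hD); set_tac.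
Qed.

End Tangles.

(** * Separations, triangles and triads in a 3-connected matroid *)

Section Separations.
Variables (T : finType) (M : matroid T).
Hypotheses (hM : matroid_axioms M) (h3 : three_connected M).
Local Notation E := (ground M).
Local Notation lam := (lambda M).
Local Notation rb := (rkb M).
Implicit Types (X Y Z A B S P Q : {set T}) (e x y a c : T) (b : bool).

Lemma card_compl X : X \subset E -> #|E :\: X| = #|E| - #|X|.
Proof. by move=> sX; rewrite cardsD (setIidPr sX). Qed.

Lemma lambda_ge2 X : X \subset E -> 1 < #|X| -> 1 < #|E :\: X| -> 1 < lam X.
Proof. by move=> sX c1 c2; apply: (h3 (k := 2)). Qed.

(** By submodularity the two values sum to at most 4, and 3-connectivity makes each at least 2. *)
Lemma uncross P Q : P \subset E -> Q \subset E -> lam P <= 2 -> lam Q <= 2 ->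
  1 < #|P :&: Q| -> 1 < #|E :\: (P :|: Q)| -> lam (P :&: Q) = 2 /\ lam (P :|: Q) = 2.
Proof.
move=> sP sQ lP lQ cI cU.
have sI : P :&: Q \subset E by set_tac.
have sU : P :|: Q \subset E by set_tac.
have hs : E :\: (P :|: Q) \subset E :\: (P :&: Q) by set_tac.
have hs' : P :&: Q \subset P :|: Q by set_tac.
have := lambda_ge2 sI cI (leq_trans cU (subset_leq_card hs)).
have := lambda_ge2 sU (leq_trans cI (subset_leq_card hs')) cU.
have := lambda_submod hM sP sQ; nlia.
Qed.

(* In a 3-connected matroid this says that (A, E - A - e) is a 2-separation
   of M / e if b is true, and of M \ e if b is false. *)
Definition sep_at b e A := [&& e \in E, e \notin A, A \subset E, 1 < #|A|,
  lam A == 2, lam (e |: A) == 2 & in_cl M b A e].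

Lemma sep_atP b e A : reflect
  ([/\ e \in E, e \notin A, A \subset E & 1 < #|A|] /\
   [/\ lam A = 2, lam (e |: A) = 2 & in_cl M b A e]) (sep_at b e A).
Proof.
apply: (iffP idP) => [/and5P[-> -> -> -> /and3P[/eqP -> /eqP -> ->]]//|].
by case=> -[h1 h2 h3' h4] [h5 h6 h7]; rewrite /sep_at h1 h2 h3' h4 h5 h6 h7.
Qed.

Lemma in_cl_compl b e A : e \in E -> A \subset E -> e \notin A ->
  lam (e |: A) = lam A -> in_cl M b A e -> in_cl M b (E :\: (e |: A)) e.
Proof.
move=> he sA eA l /eqP c; have sA' : e |: A \subset E by set_tac.
have := lambdaE hM b sA; have := lambdaE hM b sA'.
rewrite /in_cl; have -> : e |: (E :\: (e |: A)) = E :\: A by set_tac.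
by move=> h1 h2; apply/eqP; nlia.
Qed.

Lemma sep_at_compl b e A : sep_at b e A -> 1 < #|E :\: (e |: A)| ->
  sep_at b e (E :\: (e |: A)).
Proof.
move=> /sep_atP[[he eA sA cA] [l1 l2 c]] h; apply/sep_atP.
have sA' : e |: A \subset E by set_tac.
have eq1 : e |: (E :\: (e |: A)) = E :\: A by set_tac.
split; first by rewrite subsetDl h he !inE eqxx.
by rewrite eq1 !lambdaC // l1 l2; split=> //; apply: in_cl_compl; rewrite ?l1 ?l2.
Qed.

(* A smaller separation at [e] has the same type: otherwise [e] would be
   spanned by [E - A] and cospanned by a subset of [A]. *)
Lemma sep_at_sub b e A A' : sep_at b e A -> A' \subset A -> 1 < #|A'| ->
  lam A' = 2 -> lam (e |: A') = 2 -> sep_at b e A'.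
Proof.
move=> /sep_atP[[he eA sA cA] [l1 l2 c]] sA' cA' l1' l2'; apply/sep_atP.
have eA' : e \notin A' by apply: contra eA; apply: (subsetP sA').
have sE : A' \subset E by set_tac.
split; [by split|split=> //]; apply/negPn/negP => nc.
have sE' : e |: A' \subset E by set_tac.
have := lambda_card hM b sE; have := lambda_card hM b sE'; rewrite cardsU1 eA'.
have := rkbU1 hM b e A'; have := rkb_mono hM b (subsetU1 e A').
move: nc; rewrite /in_cl => /eqP nc h1 h2 h3' h4.
have c' : in_cl M (~~ b) A' e by rewrite /in_cl; apply/eqP; nlia.
apply: (@in_cl_orth _ _ hM b e (E :\: (e |: A)) A') => //.
- exact: subsetDl.
- by rewrite !inE eqxx.
- by set_tac.
- by apply: in_cl_compl => //; rewrite l1 l2.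
Qed.

(** Uncrossing A with A', and A + e with A' + e, makes the intersection of A and A' a separation at
    e of both types. Then e is both spanned and cospanned by it, and adding e would lower the
    connectivity below 2. *)
Lemma sep_at_conflict b e A A' : sep_at b e A -> sep_at (~~ b) e A' ->
  1 < #|A :&: A'| -> 1 < #|E :\: (e |: (A :|: A'))| -> False.
Proof.
move=> sp sp' cI cU.
case/sep_atP: (sp) => -[he eA sA cA] [l1 l2 c].
case/sep_atP: (sp') => -[_ eA' sA' cA'] [l1' l2' c'].
have [lI _] : lam (A :&: A') = 2 /\ lam (A :|: A') = 2.
  apply: uncross; rewrite ?l1 ?l1' //; apply: leq_trans cU (subset_leq_card _).
  by set_tac.
have [lI' _] : lam ((e |: A) :&: (e |: A')) = 2 /\ lam ((e |: A) :|: (e |: A')) = 2.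
  apply: uncross; rewrite ?l2 ?l2' //; try by set_tac.
    by apply: leq_trans cI (subset_leq_card _); set_tac.
  by apply: leq_trans cU (subset_leq_card _); set_tac.
have eq1 : (e |: A) :&: (e |: A') = e |: (A :&: A') by set_tac.
rewrite eq1 in lI'.
have /sep_atP[[_ eI sI _] [_ _ d]] := sep_at_sub sp (subsetIl _ _) cI lI lI'.
have /sep_atP[_ [_ _ d']] := sep_at_sub sp' (subsetIr _ _) cI lI lI'.
have := lambda_cl2 hM he sI eI d d'; nlia.
Qed.

(** Moves a separation at an element of [A] inside [A]: uncross [A] with A' and with A' + c. *)
Lemma sep_at_capture b c A A' : A \subset E -> lam A = 2 -> c \in A ->
  sep_at b c A' -> 1 < #|A :&: A'| -> 1 < #|E :\: (A :|: A')| ->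
  sep_at b c (A :&: A').
Proof.
move=> sA lA cA sp cI cU; case/sep_atP: (sp) => -[he eA' sA' cA'] [l1 l2 d].
have [lI _] : lam (A :&: A') = 2 /\ lam (A :|: A') = 2.
  by apply: uncross; rewrite ?lA ?l1.
have [lI' _] : lam (A :&: (c |: A')) = 2 /\ lam (A :|: (c |: A')) = 2.
  apply: uncross; rewrite ?lA ?l2 //; try by set_tac.
    by apply: leq_trans cI (subset_leq_card _); set_tac.
  by apply: leq_trans cU (subset_leq_card _); set_tac.
apply: (sep_at_sub sp) => //; first exact: subsetIr.
by have <- : A :&: (c |: A') = c |: (A :&: A') by set_tac.
Qed.

(** Sets of two or three elements then leave at least two outside, so [lambda_ge2] applies to
    them. *)
Hypothesis hE : 4 < #|E|.

(* A triangle if b is true, a triad if b is false. *)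
Definition tri b S := [&& S \subset E, #|S| == 3 & rb b S == 2].

Lemma triP b S : reflect [/\ S \subset E, #|S| = 3 & rb b S = 2] (tri b S).
Proof. by apply: (iffP and3P) => -[h /eqP h1 /eqP h2]. Qed.

Lemma rkb_pair b X : X \subset E -> #|X| = 2 -> rb b X = 2.
Proof.
move=> sX cX; have : 1 < lam X.
  by apply: lambda_ge2; rewrite ?card_compl ?cX //; nlia.
have := lambda_card hM b sX; have := rkb_card hM b X; have := rkb_card hM (~~ b) X; nlia.
Qed.

Lemma tri_lambda b S : tri b S -> lam S = 2.
Proof.
case/triP => sS cS rS; have : 1 < lam S.
  by apply: lambda_ge2; rewrite ?card_compl ?cS //; nlia.
have := lambda_card hM b sS; have := rkb_card hM (~~ b) S; nlia.
Qed.

Lemma tri_in_cl b S x : tri b S -> x \in S -> in_cl M b (S :\ x) x.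
Proof.
case/triP => sS cS rS xS; rewrite /in_cl setD1K // rS eq_sym; apply/eqP.
apply: rkb_pair; first by set_tac.
by have := cardsD1 x S; rewrite xS; nlia.
Qed.

Lemma sep_at_tri b e A : sep_at b e A -> #|A| = 2 -> tri b (e |: A).
Proof.
case/sep_atP => -[he eA sA _] [_ _ /eqP c] cA; apply/triP.
by split; [set_tac | rewrite cardsU1 eA cA | rewrite c; apply: rkb_pair].
Qed.

(** Orthogonality rules out a single common element. If the sets were equal, rank and corank would
    both be 2 and the connectivity 2 + 2 - 3 = 1. *)
Lemma tri_meet b S S' a : tri b S -> tri (~~ b) S' -> a \in S -> a \in S' ->
  #|S :&: S'| = 2.
Proof.
move=> tS tS' aS aS'.
case/triP: (tS) => sS cS rS; case/triP: (tS') => sS' cS' rS'.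
have aI : a \in S :&: S' by rewrite inE aS.
have := subset_leq_card (subsetIl S S'); rewrite cS leq_eqVlt => /orP[/eqP cI|cI].
  have eS : S :&: S' = S by apply/eqP; rewrite eqEcard subsetIl cS cI.
  have eS' : S :&: S' = S' by apply/eqP; rewrite eqEcard subsetIr cS' cI.
  have rS2 : rb (~~ b) S = 2 by rewrite -eS eS'.
  by have := lambda_card hM b sS; rewrite rS (tri_lambda tS) rS2 cS; nlia.
suff : 1 < #|S :&: S'| by nlia.
rewrite ltnNge; apply/negP => cI'.
have eI : S :&: S' = [set a].
  by apply/eqP; rewrite eq_sym eqEcard sub1set aI cards1.
apply: (@in_cl_orth _ _ hM b a (S :\ a) (S' :\ a)).
- exact: (subsetP sS).
- by set_tac.
- by set_tac.
- by rewrite !inE eqxx.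
- by rewrite !inE eqxx.
- apply/subsetP => z; rewrite !inE => /andP[za zS]; rewrite za /=; apply/negP => zS'.
  by have : z \in S :&: S' by [rewrite inE zS]; rewrite eI inE (negbTE za).
- exact: tri_in_cl.
- exact: tri_in_cl.
Qed.

(* [g] is both spanned and cospanned by the side of [f], so moving it there
   leaves a set of at most one element. *)
Lemma tri_sep_card b e f g X : sep_at b e X -> tri (~~ b) [set e; f; g] ->
  f \in X -> g \notin X -> g != e -> in_cl M b (e |: X) g ->
  #|E :\: (e |: X)| <= 2.
Proof.
case/sep_atP => -[he eX sX cX] [_ l2 _] t fX gX ge c.
case/triP: (t) => sS cS _.
have gE : g \in E by apply: (subsetP sS); rewrite !inE eqxx !orbT.
have c' : in_cl M (~~ b) (e |: X) g.
  have gS : g \in [set e; f; g] by rewrite !inE eqxx !orbT.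
  by apply: in_cl_mono (tri_in_cl t gS) => //; set_tac.
have sX' : e |: X \subset E by set_tac.
have gX' : g \notin e |: X by rewrite !inE negb_or ge.
have := lambda_cl2 hM gE sX' gX' c c'; rewrite l2 => l.
have sX'' : g |: (e |: X) \subset E by set_tac.
have cg := cardsD1 g (E :\: (e |: X)); rewrite in_setD gX' gE in cg.
have eq1 : (E :\: (e |: X)) :\ g = E :\: (g |: (e |: X)) by set_tac.
rewrite eq1 in cg.
rewrite leqNgt; apply/negP => h; have : 1 < lam (g |: (e |: X)).
  apply: lambda_ge2 => //; last by nlia.
  by rewrite !cardsU1 gX' eX; nlia.
by nlia.
Qed.

(* Otherwise [e] would be both spanned and cospanned by [X]. *)
Lemma tri_separated b e f g X : sep_at b e X -> tri (~~ b) [set e; f; g] ->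
  f != e -> g != e -> f \in X -> g \in X -> False.
Proof.
move=> sp t fe ge fX gX; case/sep_atP: (sp) => -[he eX sX cX] [l1 l2 c].
have eS : e \in [set e; f; g] by rewrite !inE eqxx.
have c' : in_cl M (~~ b) X e.
  by apply: in_cl_mono (tri_in_cl t eS) => //; set_tac.
by have := lambda_cl2 hM he sX eX c c'; nlia.
Qed.

End Separations.

(** * Separations with a side in the tangle *)

Section Stuck.
Variables (T : finType) (M : matroid T) (Tg : {set {set T}}) (th : nat).
Hypotheses (hM : matroid_axioms M) (h3 : three_connected M).
Hypotheses (hT : is_tangle M Tg th) (th2 : 2 < th).
Local Notation E := (ground M).
Local Notation lam := (lambda M).
Local Notation rb := (rkb M).
Local Notation sep_at := (sep_at M).
Local Notation tri := (tri M).
Implicit Types (X Y Z A B S P Q : {set T}) (e x y a c : T) (b : bool).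

Lemma tangle_card_ground : 4 < #|E|.
Proof.
have th1 : 1 < th by nlia.
have h0 : set0 \in Tg by apply: (tangle_small hM hT); rewrite ?sub0set ?cards0 //; nlia.
have := tangle_compl hM hT th2 h0; rewrite setD0 => c2.
have /card_gt1P[x [y [hx hy xy]]] : 1 < #|E| by nlia.
have hxy : [set x; y] \in Tg.
  apply: (tangle_small hM hT) => //; last by rewrite cards2 xy; nlia.
  by set_tac.
have := tangle_compl hM hT th2 hxy; have sxy := tangle_sub hT hxy.
by rewrite card_compl // cards2 xy; nlia.
Qed.

Let hE := tangle_card_ground.
Let th1 : 1 < th. Proof. by nlia. Qed.

Lemma tangle_lambda_ge2 X : X \in Tg -> 1 < #|X| -> 1 < lam X.
Proof.
move=> hX cX; apply: (lambda_ge2 h3) => //; first exact: (tangle_sub hT hX).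
by have := tangle_compl hM hT th2 hX; nlia.
Qed.

Lemma sep_at_tangle b e A : sep_at b e A -> A \in Tg -> e |: A \in Tg.
Proof.
case/sep_atP => -[he eA sA _] [_ l _] hA.
by apply: (tangle_setU1 hM hT) => //; rewrite l.
Qed.

Lemma tri_tangle b S : tri b S -> S \in Tg.
Proof.
move=> t; case/triP: (t) => sS cS rS.
have /card_gt0P[x xS] : 0 < #|S| by nlia.
rewrite -(setD1K xS); apply: (tangle_setU1 hM hT) => //.
- exact: (subsetP sS).
- apply: (tangle_small hM hT) => //; first by set_tac.
  by have := cardsD1 x S; rewrite xS; nlia.
- by rewrite setD1K // (tri_lambda hM h3 hE t).
Qed.

(** If A and A' share two elements they conflict directly, since the tangle keeps A + e and A' from
    covering all but one element. Otherwise, if both had three elements, A would conflict with the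
    other side of A', as A - A' and A' - A would have two elements each. *)
Lemma sep_at_opposite b e A A' : sep_at b e A -> sep_at (~~ b) e A' ->
  A \in Tg -> A' \in Tg -> #|A| = 2 \/ #|A'| = 2.
Proof.
move=> sp sp' hA hA'.
case/sep_atP: (sp) => -[he eA sA cA] [l1 l2 _].
case/sep_atP: (sp') => -[_ eA' sA' cA'] [l1' l2' _].
have hAe := sep_at_tangle sp hA.
case: (ltnP 1 #|A :&: A'|) => cI.
  exfalso; apply: (sep_at_conflict hM h3 sp sp' cI _).
  rewrite ltnNge; apply/negP => c1.
  have hD : E :\: (e |: (A :|: A')) \in Tg.
    by apply: (tangle_small hM hT) => //; [apply: subsetDl | nlia].
  by apply: (tangle_cover hT hAe hA' hD); set_tac.
case: (ltnP 2 #|A|) => c3; last by left; nlia.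
case: (ltnP 2 #|A'|) => c3'; last by right; nlia.
exfalso; set B' := E :\: (e |: A').
have cB' : 1 < #|B'|.
  by have := tangle_compl hM hT th2 (sep_at_tangle sp' hA'); rewrite -/B'; nlia.
have spB := sep_at_compl hM sp' cB'.
have e1 : A :\: A' = A :&: B' by rewrite /B'; set_tac.
apply: (sep_at_conflict hM h3 sp spB _ _).
  by rewrite -/B' -e1; have := cardsID A' A; nlia.
rewrite -/B'.
have -> : E :\: (e |: (A :|: B')) = A' :\: A by rewrite /B'; set_tac.
by have := cardsID A A'; rewrite setIC; nlia.
Qed.

(* [Nrem b e] stands for: the fixed minor [N] is a minor of [M / e] if [b] is
   true, and of [M \ e] if [b] is false. *)
Variables (F : {set T}) (Nrem : bool -> T -> Prop).
Hypotheses (hF : F \in Tg)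
  (clF : forall A, A \in Tg -> lam (A :|: F) <= lam F -> A \subset F).
Hypothesis Nrem_or : forall e, e \in E -> e \notin F -> exists b, Nrem b e.
Hypothesis Nrem_tri : forall b S e a, tri b S -> e \in S -> a \in S -> a != e ->
  a \notin F -> Nrem b e -> Nrem (~~ b) a.
(** The assumption that [stuck_absurd] refutes. *)
Hypothesis stuck : forall b e, e \in E -> e \notin F -> Nrem b e ->
  exists2 A, A \in Tg & sep_at b e A.

(** Two common elements would give the intersection connectivity at least 2. By submodularity adding
    [S] to [F] would not raise the connectivity of [F], so [S] would lie in [F], against [x]. *)
Lemma card_capF S x : S \in Tg -> lam S <= 2 -> x \in S -> x \notin F ->
  #|S :&: F| <= 1.
Proof.
move=> hS lS xS xF; rewrite leqNgt; apply/negP => cI; move/negP: xF; apply.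
have sS := tangle_sub hT hS; have sF := tangle_sub hT hF.
apply: (subsetP (clF hS _)) xS.
have : 1 < lam (S :&: F).
  apply: (lambda_ge2 h3) => //; first by set_tac.
  have := tangle_compl hM hT th2 hS => h; apply: (leq_trans (ltnW h) (subset_leq_card _)).
  by set_tac.
by have := lambda_submod hM sS sF; nlia.
Qed.

Lemma pick_notF X : #|X :&: F| < #|X| -> exists2 x, x \in X & x \notin F.
Proof.
move=> h; have /card_gt0P[x] : 0 < #|X :\: F| by have := cardsID F X; nlia.
by rewrite inE => /andP[h1 h2]; exists x.
Qed.

(** * Four-element fans *)

Definition has_fan := exists b x1 x2 x3 x4,
  [/\ uniq [:: x1; x2; x3; x4], tri b [set x1; x2; x3],
      tri (~~ b) [set x2; x3; x4] & #|[set x1; x2; x3; x4] :&: F| <= 1].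

Lemma fan_tangle b x1 x2 x3 x4 : uniq [:: x1; x2; x3; x4] ->
  tri b [set x1; x2; x3] -> tri (~~ b) [set x2; x3; x4] ->
  [set x1; x2; x3; x4] \in Tg /\ lam [set x1; x2; x3; x4] = 2.
Proof.
move=> u t t'; have hS' := tri_tangle t'; have lS' := tri_lambda hM h3 hE t'.
have sS' := tangle_sub hT hS'.
case/triP: (t) => sS _ _.
have x1S : x1 \in [set x1; x2; x3] by rewrite !inE eqxx.
have x1E := subsetP sS _ x1S.
have x1S' : x1 \notin [set x2; x3; x4].
  by move: u; rewrite /= !inE => /andP[]; rewrite -!orbA.
have eq1 : [set x1; x2; x3; x4] = x1 |: [set x2; x3; x4] by rewrite -!setUA.
have c : in_cl M b [set x2; x3; x4] x1.
  apply: (in_cl_mono hM _ (tri_in_cl hM h3 hE t x1S)).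
  by set_tac.
have l := lambda_cl hM x1E sS' x1S' c; rewrite lS' -eq1 in l.
have hU : [set x1; x2; x3; x4] \in Tg.
  by rewrite eq1; apply: (tangle_setU1 hM hT) => //; rewrite -eq1; nlia.
have cU : #|[set x1; x2; x3; x4]| = 4.
  by rewrite eq1 cardsU1 x1S'; case/triP: t' => _ -> _.
by split=> //; have := tangle_lambda_ge2 hU; rewrite cU => /(_ isT); nlia.
Qed.

(** By [tri_meet] exactly two elements are shared. They form the middle of the fan, and the two
    unshared ones are its ends. *)
Lemma fan_of_tri b S S' a : tri b S -> tri (~~ b) S' -> a \in S -> a \in S' ->
  a \notin F -> has_fan.
Proof.
move=> t t' aS aS' aF; have cI := tri_meet hM h3 hE t t' aS aS'.
have /cards2P[x2 [x3 [x23 eI]]] : #|S :&: S'| == 2 by rewrite cI.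
case/triP: (t) => sS cS _; case/triP: (t') => sS' cS' _.
have /cards1P[x1 e1] : #|S :\: S'| == 1 by apply/eqP; have := cardsID S' S; nlia.
have /cards1P[x4 e4] : #|S' :\: S| == 1.
  by apply/eqP; have := cardsID S S'; rewrite setIC; nlia.
have eS : S = [set x1; x2; x3] by rewrite -setUA -eI -e1 setUC setID.
have eS' : S' = [set x2; x3; x4] by rewrite -eI -e4 setIC setID.
have u : uniq [:: x1; x2; x3; x4].
  have : x1 \in S :\: S' by rewrite e1 inE.
  have : x4 \in S' :\: S by rewrite e4 inE.
  rewrite eS eS' /= !inE (negbTE x23) !negb_or.
  rewrite [x4 == x1]eq_sym [x4 == x2]eq_sym [x4 == x3]eq_sym.
  by do !case: (_ == _).
rewrite eS in t; rewrite eS' in t'; exists b, x1, x2, x3, x4; split=> //.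
have [h l] := fan_tangle u t t'.
apply: (card_capF h _ _ aF); first by rewrite l.
by move: aS; rewrite eS !inE => ->.
Qed.

(** Two elements of [S] avoid [F]. If the first can only be removed in type [b], then [Nrem_tri]
    gives the second the opposite type. *)
Lemma tri_notF_rem b S : tri b S -> #|S :&: F| <= 1 ->
  exists a, [/\ a \in S, a \notin F & Nrem (~~ b) a].
Proof.
move=> t cF; case/triP: (t) => sS cS _.
have [x xS xF] : exists2 x, x \in S & x \notin F by apply: pick_notF; nlia.
have [a aS aF] : exists2 a, a \in S :\ x & a \notin F.
  apply: pick_notF; have := cardsD1 x S; rewrite xS cS.
  have hs : (S :\ x) :&: F \subset S :&: F by set_tac.
  by have := subset_leq_card hs; nlia.
move: aS; rewrite !inE => /andP[ax aS].
have [b' hb'] := Nrem_or (subsetP sS _ xS) xF.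
have [bb|bb] := eqVneq b' b.
  by exists a; split=> //; apply: (Nrem_tri t xS aS ax aF); rewrite -bb.
by exists x; split=> //; have -> : ~~ b = b' by case: b' b bb {t hb'} => -[].
Qed.

(** [X] is whichever side of the separation contains [c]. By [tri_separated] neither side contains
    both [x] and [y], so each side gets one of them. *)
Lemma tri_sep_side b a x y c A : A \in Tg -> sep_at b a A ->
  tri (~~ b) [set a; x; y] -> x != a -> y != a -> c \in E -> c != a ->
  exists X f g, [/\ sep_at b a X, 1 < #|E :\: (a |: X)|, [set f; g] = [set x; y],
    c \in X & (f \in X) && (g \notin X)].
Proof.
move=> hA sp t xa ya cE ca; case/triP: (t) => sS _ _.
have cB : 1 < #|E :\: (a |: A)|.
  by have := tangle_compl hM hT th2 (sep_at_tangle sp hA); nlia.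
have sp' := sep_at_compl hM sp cB.
have cA : 1 < #|A| by case/sep_atP: sp => -[].
have aA : a \notin A by case/sep_atP: sp => -[].
have aE : a \in E by case/sep_atP: sp => -[].
have sA := tangle_sub hT hA.
have eBB : E :\: (a |: (E :\: (a |: A))) = A by set_tac.
have xE : x \in E by apply: (subsetP sS); rewrite !inE eqxx orbT.
have yE : y \in E by apply: (subsetP sS); rewrite !inE eqxx orbT.
have inB z : z \in E -> z != a -> (z \in E :\: (a |: A)) = (z \notin A).
  by move=> zE za; rewrite !inE negb_or za zE andbT.
have two X : sep_at b a X -> x \in X -> y \in X -> False.
  by move=> spX; apply: (tri_separated hM h3 hE spX t xa ya).
have pick X : sep_at b a X -> 1 < #|E :\: (a |: X)| -> (x \in X) || (y \in X) -> c \in X ->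
    exists X f g, [/\ sep_at b a X, 1 < #|E :\: (a |: X)|, [set f; g] = [set x; y],
      c \in X & (f \in X) && (g \notin X)].
  move=> spX cX; have [xX _|xX /= yX] := boolP (x \in X) => cXX.
    by exists X, x, y; rewrite xX; split=> //; apply/negP => yX; case: (two X).
  by exists X, y, x; rewrite yX xX; split=> //; rewrite setUC.
have [cA'|cA'] := boolP (c \in A).
  apply: (pick A) => //; apply/negPn/negP; rewrite negb_or => /andP[xA yA].
  by case: (two _ sp'); rewrite inB.
apply: (pick _ sp'); rewrite ?eBB ?inB //.
apply/negPn/negP; rewrite negb_or !negbK => /andP[xA yA]; exact: (two A).
Qed.

(** By [tri_sep_card] the side of [g] has just two elements, which form a triangle or triad with
    [a]. *)
Lemma tri_sep_tri b a f g X : sep_at b a X -> 1 < #|E :\: (a |: X)| ->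
  tri (~~ b) [set a; f; g] -> f \in X -> g \notin X -> g != a -> in_cl M b (a |: X) g ->
  exists2 x, x \notin g |: (a |: X) & tri b [set x; a; g].
Proof.
move=> sp cY t fX gX ga cl; have cY2 := tri_sep_card hM h3 hE sp t fX gX ga cl.
set Y := E :\: (a |: X) in cY cY2 *.
have gY : g \in Y.
  rewrite !inE negb_or ga gX /=; case/triP: t => + _ _ => /subsetP; apply.
  by rewrite !inE eqxx orbT.
have /cards1P[x ex] : #|Y :\ g| == 1.
  by apply/eqP; have := cardsD1 g Y; rewrite gY; nlia.
have : x \in Y :\ g by rewrite ex inE.
rewrite !inE => /and3P[xg xaX xE]; exists x; first by rewrite !inE (negbTE xg).
have -> : [set x; a; g] = a |: Y by rewrite -(setD1K gY) ex; set_tac.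
by apply: (sep_at_tri hM h3 hE (sep_at_compl hM sp cY)); rewrite -/Y; nlia.
Qed.

Lemma fan_of_sep3 b0 c0 A : A \in Tg -> c0 \notin F -> sep_at b0 c0 A -> #|A| = 3 ->
  has_fan.
Proof.
move=> hA c0F sp cA; case/sep_atP: (sp) => -[hc0 c0A sA _] [l1 l2 /eqP cl0].
have hAc := sep_at_tangle sp hA; have sAc := tangle_sub hT hAc.
have cF : #|A :&: F| <= 1.
  have hs : A :&: F \subset (c0 |: A) :&: F by set_tac.
  apply: (leq_trans (subset_leq_card hs) _); apply: (card_capF hAc _ _ c0F).
    by rewrite l2.
  by rewrite !inE eqxx.
have := lambda_card hM b0 sA; rewrite l1 cA => hr.
have := rkb_card hM b0 A; have := rkb_card hM (~~ b0) A; rewrite cA => hr1 hr2.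
(* Rank and corank of the three-element set A sum to 5, so A is a triangle or a triad. The case
   where it has type [b0] comes first. *)
case: (ltnP 2 (rb b0 A)) => hr3; last first.
  have rA : rb b0 A = 2 by nlia.
  have t : tri b0 A by apply/triP.
  have [a [aA aF na]] := tri_notF_rem t cF.
  have aE := subsetP sA _ aA.
  have [A' hA' sp'] := stuck aE aF na.
  (* A + c0 has rank 2 in type [b0], so exchanging a for c0 gives a three-element separation at a of
     type [b0]. The opposite separation at a must then have two elements. *)
  set Q := c0 |: (A :\ a).
  have eQ : a |: Q = c0 |: A by rewrite /Q; set_tac.
  have sQ' : Q \subset c0 |: A by rewrite /Q; set_tac.
  have sQ : Q \subset E by apply: (subset_trans sQ' sAc).
  have ac0 : a != c0 by apply: contraNneq c0A => <-.
  have aQ : a \notin Q by rewrite /Q !inE eqxx /= orbF.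
  have cQ : #|Q| = 3.
    rewrite /Q cardsU1; have := cardsD1 a A; rewrite aA cA !inE (negbTE c0A) andbF /=.
    by nlia.
  have lQ : 1 < lam Q by apply: (lambda_ge2 h3); rewrite ?card_compl ?cQ //; nlia.
  have := lambda_card hM b0 sQ; have := rkb_card hM (~~ b0) Q.
  have := rkb_mono hM b0 sQ'; rewrite cl0 rA cQ => hq1 hq2 hq3.
  have spQ : sep_at b0 a Q.
    apply/sep_atP; rewrite eQ /in_cl eQ cl0 rA cQ; do !split=> //; first by nlia.
    by apply/eqP; nlia.
  have hQ : Q \in Tg by apply: (tangle_subset hT sQ' hAc _); nlia.
  case: (sep_at_opposite spQ sp' hQ hA') => [|cA']; first by nlia.
  have t' := sep_at_tri hM h3 hE sp' cA'.
  by apply: (fan_of_tri t t' aA _ aF); rewrite !inE eqxx.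
(* Now A has the type opposite to [b0] and is independent in type [b0]. *)
have rA : rb (~~ b0) A = 2 by nlia.
have rA3 : rb b0 A = 3 by nlia.
have t : tri (~~ b0) A by apply/triP.
have [a [aA aF]] := tri_notF_rem t cF; rewrite negbK => na.
have aE := subsetP sA _ aA.
have [A' hA' sp'] := stuck aE aF na.
have ac0 : a != c0 by apply: contraNneq c0A => <-.
have /cards2P[x [y [xy exy]]] : #|A :\ a| == 2.
  by apply/eqP; have := cardsD1 a A; rewrite aA cA; nlia.
have eA : A = [set a; x; y] by rewrite -setUA -exy setD1K.
have /setD1P[xa xA] : x \in A :\ a by rewrite exy !inE eqxx.
have /setD1P[ya yA] : y \in A :\ a by rewrite exy !inE eqxx orbT.
have c0a : c0 != a by rewrite eq_sym.
have tA := t; rewrite eA in tA.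
have [X [f [g [spX cY efg c0X /andP[fX gX]]]]] := tri_sep_side hA' sp' tA xa ya hc0 c0a.
have efgA : [set a; f; g] = A by rewrite -setUA efg -exy setD1K.
have [fa fA] : f != a /\ f \in A by apply/setD1P; rewrite exy -efg !inE eqxx.
have [ga gA] : g != a /\ g \in A by apply/setD1P; rewrite exy -efg !inE eqxx orbT.
have fE := subsetP sA _ fA; have gE := subsetP sA _ gA.
have fc0 : f != c0 by apply: contraNneq c0A => <-.
have cP : #|[set a; f; c0]| = 3.
  by rewrite -setUA cardsU1 cards2 !inE fc0 negb_or ac0 eq_sym fa.
have sP : [set a; f; c0] \subset E by set_tac.
have cp2 : #|[set a; f]| = 2 by rewrite cards2 eq_sym fa.
have sp2 : [set a; f] \subset E by set_tac.
have := rkb_pair hM h3 hE b0 sp2 cp2.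
have sp3 : [set a; f] \subset [set a; f; c0] by set_tac.
have := rkb_mono hM b0 sp3; have := rkb_card hM b0 [set a; f; c0]; rewrite cP.
move=> hp1 hp2 hp3.
case: (ltnP 2 (rb b0 [set a; f; c0])) => hp4; last first.
  have t' : tri b0 [set a; f; c0] by apply/triP; split=> //; nlia.
  by apply: (fan_of_tri t' t _ aA aF); rewrite !inE eqxx.
(* The set {a, f, c0} has rank 3, the rank of A + c0, so it spans g. *)
have clg : in_cl M b0 (a |: X) g.
  apply: (@in_cl_mono _ _ hM _ [set a; f; c0]); first by set_tac.
  rewrite /in_cl; have -> : g |: [set a; f; c0] = c0 |: A by rewrite -efgA; set_tac.
  by rewrite cl0 rA3; apply/eqP; nlia.
have tfg := t; rewrite -efgA in tfg.
have [z _ tz] := tri_sep_tri spX cY tfg fX gX ga clg.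
by apply: (fan_of_tri tz t _ aA aF); rewrite !inE eqxx orbT.
Qed.

(** * A smallest separation with more than three elements *)

Section MinimalSeparation.
Variable A : {set T}.
Hypotheses (hA : A \in Tg) (lA : lam A = 2) (cA : 3 < #|A|).
Hypothesis minA : forall b c A', A' \in Tg -> c \notin F -> sep_at b c A' ->
  2 < #|A'| -> #|A| <= #|A'|.

(** Uncross [A] with the separation A' at [c]. If A meets A' in two elements, or A' - A has two
    elements, then one side of A' cuts out a smaller separation at [c] inside [A]; by minimality it
    has two elements. Otherwise A' has two elements, one of them in [A]. *)
Lemma tri_meets_minimal b c : c \in A -> c \notin F -> Nrem b c ->
  exists S, [/\ tri b S, c \in S & 1 < #|S :&: A|].
Proof.
move=> cAc cF nc; have sA := tangle_sub hT hA.
have cE := subsetP sA _ cAc.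
have [A' hA' sp] := stuck cE cF nc.
case/sep_atP: (sp) => -[_ cA' sA' cdA'] _.
have hAc := sep_at_tangle sp hA'.
have cap2 X : sep_at b c X -> X \subset A -> #|X| < #|A| -> X \in Tg ->
    exists S, [/\ tri b S, c \in S & 1 < #|S :&: A|].
  move=> spX sX cX hX; exists (c |: X).
  have cX2 : #|X| = 2.
    case/sep_atP: (spX) => -[_ _ _ c1] _.
    by case: (ltnP 2 #|X|) => h; [have := minA hX cF spX h; nlia | nlia].
  split; [exact: (sep_at_tri hM h3 hE spX cX2) | by rewrite !inE eqxx |].
  by rewrite -cX2; apply: subset_leq_card; set_tac.
have small X : X \subset A :\ c -> #|X| < #|A|.
  by move/subset_leq_card; have := cardsD1 c A; rewrite cAc; nlia.
have sub X : X \subset A -> sep_at b c X -> X \in Tg.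
  move=> sX /sep_atP[_ [l _ _]]; apply: (tangle_subset hT sX hA _); by rewrite l.
case: (ltnP 1 #|A :&: A'|) => cI.
  have spI : sep_at b c (A :&: A').
    apply: (sep_at_capture hM h3 _ _ _ sp cI _) => //.
    rewrite ltnNge; apply/negP => c1.
    have hD : E :\: (A :|: A') \in Tg.
      by apply: (tangle_small hM hT) => //; [apply: subsetDl | nlia].
    by apply: (tangle_cover hT hA hA' hD); set_tac.
  have sI : A :&: A' \subset A by apply: subsetIl.
  by apply: (cap2 _ spI sI _ (sub _ sI spI)); apply: small; set_tac.
set B' := E :\: (c |: A').
have cB' : 1 < #|B'| by have := tangle_compl hM hT th2 hAc; rewrite -/B'; nlia.
have spB := sep_at_compl hM sp cB'; rewrite -/B' in spB.
have cIB : 1 < #|A :&: B'|.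
  have -> : A :&: B' = (A :\ c) :\: A' by rewrite /B'; set_tac.
  have := cardsD1 c A; have := cardsID A' (A :\ c); rewrite cAc.
  have hs : (A :\ c) :&: A' \subset A :&: A' by set_tac.
  by have := subset_leq_card hs; nlia.
case: (ltnP 1 #|A' :\: A|) => cD.
  have spI : sep_at b c (A :&: B').
    apply: (sep_at_capture hM h3 _ _ _ spB cIB _) => //.
    by have -> : E :\: (A :|: B') = A' :\: A by rewrite /B'; set_tac.
  have sI : A :&: B' \subset A by apply: subsetIl.
  apply: (cap2 _ spI sI _ (sub _ sI spI)); apply: small; rewrite /B'; set_tac.
have cID := cardsID A A'; rewrite setIC in cID.
exists (c |: A'); split.
- by apply: (sep_at_tri hM h3 hE sp _); nlia.
- by rewrite !inE eqxx.
- have -> : (c |: A') :&: A = c |: (A :&: A') by set_tac.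
  by rewrite cardsU1 !inE (negbTE cA') andbF; nlia.
Qed.

Lemma fan_of_minimal b0 c0 : c0 \notin F -> sep_at b0 c0 A -> has_fan.
Proof.
move=> c0F sp; case/sep_atP: (sp) => -[hc0 c0A sA _] [_ l2 _].
have hAc := sep_at_tangle sp hA.
have cF : #|A :&: F| <= 1.
  have hs : A :&: F \subset (c0 |: A) :&: F by set_tac.
  apply: (leq_trans (subset_leq_card hs) _); apply: (card_capF hAc _ _ c0F).
    by rewrite l2.
  by rewrite !inE eqxx.
have [c cAc cnF] : exists2 c, c \in A & c \notin F by apply: pick_notF; nlia.
have [b nc] := Nrem_or (subsetP sA _ cAc) cnF.
have [S [t cS cSA]] := tri_meets_minimal cAc cnF nc.
case/triP: (t) => sS cdS _.
have lS := tri_lambda hM h3 hE t.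
have cSF : #|S :&: F| <= 1.
  by apply: (card_capF (tri_tangle t) _ cS cnF); rewrite lS.
have /card_gt0P[w] : 0 < #|(S :&: A) :\ c|.
  by have := cardsD1 c (S :&: A); rewrite inE cS cAc; nlia.
rewrite !inE => /and3P[wc wS wA].
(* A second element of S in A and outside F is removable in the opposite type, so it lies in an
   opposite triangle or triad. *)
have finish z : z \in S -> z \in A -> z != c -> z \notin F -> has_fan.
  move=> zS zA zc zF; have nz := Nrem_tri t cS zS zc zF nc.
  have [S' [t' zS' _]] := tri_meets_minimal zA zF nz.
  exact: (fan_of_tri t t' zS zS' zF).
have [wF|wF] := boolP (w \in F); last exact: (finish _ wS wA wc wF).
have /cards1P[z ez] : #|(S :\ c) :\ w| == 1.
  have := cardsD1 c S; have := cardsD1 w (S :\ c); rewrite !inE wc wS cS cdS.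
  by move=> h1 h2; apply/eqP; nlia.
have : z \in (S :\ c) :\ w by rewrite ez inE.
rewrite !inE => /and3P[zw zc zS].
have zF : z \notin F.
  apply/negP => zF; have : 1 < #|S :&: F|.
    by apply/card_gt1P; exists z, w; rewrite !inE zS zF wS wF.
  by nlia.
have [zA|zA] := boolP (z \in A); first exact: (finish _ zS zA zc zF).
have zE := subsetP sS _ zS.
have nz := Nrem_tri t cS zS zc zF nc.
(* Here S = {c, w, z} with c and w in A, so A itself is a separation at z. Being large, it forces
   the opposite separation at z to have two elements. *)
have clz : in_cl M b A z.
  apply: (in_cl_mono hM _ (tri_in_cl hM h3 hE t zS)).
  apply/subsetP => u; rewrite !inE => /andP[uz uS].
  have [->//|uc] := eqVneq u c; have [->//|uw] := eqVneq u w.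
  by have : u \in (S :\ c) :\ w; [rewrite !inE uc uw | rewrite ez inE (negbTE uz)].
have lz := lambda_cl hM zE sA zA clz.
have hAz : z |: A \in Tg by apply: (tangle_setU1 hM hT) => //; nlia.
have lz2 : 1 < lam (z |: A).
  by apply: tangle_lambda_ge2 => //; rewrite cardsU1 zA; nlia.
have spz : sep_at b z A by apply/sep_atP; do !split=> //; nlia.
have [A' hA' sp'] := stuck zE zF nz.
case: (sep_at_opposite spz sp' hA hA') => [|cA']; first by nlia.
have t' := sep_at_tri hM h3 hE sp' cA'.
by apply: (fan_of_tri t t' zS _ zF); rewrite !inE eqxx.
Qed.

End MinimalSeparation.

Lemma stuck_has_fan : has_fan.
Proof.
pose big A := [&& A \in Tg, 2 < #|A| &
  [exists c, (c \notin F) && (sep_at true c A || sep_at false c A)]].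
have bigI b c A : A \in Tg -> c \notin F -> sep_at b c A -> 2 < #|A| -> big A.
  move=> hA cF sp cA; apply/and3P; split=> //; apply/existsP; exists c.
  by rewrite cF; case: b sp => ->; rewrite ?orbT.
case: (pickP big) => [A0 bA0|nobig].
  case: (@arg_minnP _ A0 big (fun A => #|A|) bA0) => A bA mA.
  case/and3P: bA => hA cA /existsP[c /andP[cF sp']].
  have [b sp] : exists b, sep_at b c A by case/orP: sp'; [exists true | exists false].
  case: (ltnP 3 #|A|) => c3; last by apply: (fan_of_sep3 hA cF sp _); nlia.
  apply: (fan_of_minimal hA _ c3 _ cF sp); first by case/sep_atP: sp => _ [].
  by move=> b' c' A' hA' c'F spA' cA'; apply: mA; apply: (bigI _ _ _ hA' c'F spA' cA').
(* Without large separations every blocking separation has two elements, hence gives a triangle or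
   triad at once. *)
have sep2 b e : e \in E -> e \notin F -> Nrem b e ->
    exists2 A, A \in Tg & sep_at b e A /\ #|A| = 2.
  move=> eE eF ne; have [A hA sp] := stuck eE eF ne; exists A => //; split=> //.
  case/sep_atP: (sp) => -[_ _ _ cA] _; case: (ltnP 2 #|A|) => [c3|]; last by nlia.
  by have := nobig A; rewrite (bigI _ _ _ hA eF sp c3).
have sF := tangle_sub hT hF.
have /card_gt0P[e] : 0 < #|E :\: F| by have := tangle_compl hM hT th2 hF; nlia.
rewrite !inE => /andP[eF eE].
have [b ne] := Nrem_or eE eF.
have [A hA [sp cA]] := sep2 _ _ eE eF ne.
have t := sep_at_tri hM h3 hE sp cA.
case/sep_atP: (sp) => -[_ eA sA _] [_ l2 _].
have cF : #|(e |: A) :&: F| <= 1.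
  by apply: (card_capF (sep_at_tangle sp hA) _ _ eF); rewrite ?l2 // !inE eqxx.
have [a aA aF] : exists2 a, a \in A & a \notin F.
  apply: pick_notF; have hs : A :&: F \subset (e |: A) :&: F by set_tac.
  by have := subset_leq_card hs; nlia.
have aE := subsetP sA _ aA.
have ae : a != e by apply: contraNneq eA => <-.
have eS : e \in e |: A by rewrite !inE eqxx.
have aS : a \in e |: A by rewrite !inE aA orbT.
have na := Nrem_tri t eS aS ae aF ne.
have [A' hA' [sp' cA']] := sep2 _ _ aE aF na.
have t' := sep_at_tri hM h3 hE sp' cA'.
by apply: (fan_of_tri t t' aS _ aF); rewrite !inE eqxx.
Qed.

(** * Growing a fan *)

(** In the separation blocking [e1], take the side with [e4]. It holds one of [e2], [e3], and with
    [e4] this spans the other, so the far side has only two elements: that other one and the new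
    [x]. *)
Lemma fan_extend b e1 e2 e3 e4 : e1 \notin F -> Nrem b e1 ->
  uniq [:: e1; e2; e3; e4] -> tri (~~ b) [set e1; e2; e3] -> tri b [set e2; e3; e4] ->
  exists x v, [/\ v \in [set e2; e3], tri b [set x; e1; v] & x \notin [set e1; e2; e3]].
Proof.
move=> eF ne u t t'.
case/triP: (t) => sS _ _; case/triP: (t') => sS' _ _.
have e1E : e1 \in E by apply: (subsetP sS); rewrite !inE eqxx.
have e4E : e4 \in E by apply: (subsetP sS'); rewrite !inE eqxx orbT.
move: u; rewrite /= !inE !negb_or => /and4P[/and3P[u12 u13 u14] /andP[u23 u24] u34 _].
have [A hA sp] := stuck e1E eF ne.
have v12 : e2 != e1 by rewrite eq_sym.
have v13 : e3 != e1 by rewrite eq_sym.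
have v14 : e4 != e1 by rewrite eq_sym.
have [X [f [g [spX cY efg c0X /andP[fX gX]]]]] := tri_sep_side hA sp t v12 v13 e4E v14.
have gI : g \in [set e2; e3] by rewrite -efg !inE eqxx orbT.
have ga : g != e1 by move: gI; rewrite !inE => /orP[] /eqP ->.
have t1 : tri (~~ b) [set e1; f; g] by rewrite -setUA efg setUA.
have t2 : tri b [set f; g; e4] by rewrite efg.
have gS : g \in [set f; g; e4] by rewrite !inE eqxx orbT.
have clg : in_cl M b (e1 |: X) g.
  by apply: in_cl_mono (tri_in_cl hM h3 hE t2 gS) => //; set_tac.
have [x xX tx] := tri_sep_tri spX cY t1 fX gX ga clg.
exists x, g; split=> //; rewrite -setUA -efg; move: xX; apply: contra.
rewrite !inE => /orP[->|/orP[/eqP ->|->]]; by rewrite ?orbT // fX !orbT.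
Qed.

(* Otherwise [e] would be both spanned and cospanned by [S - e]. *)
Lemma fan_extend_new b S e f g x v : S \in Tg -> 1 < #|S| -> lam (S :\ e) <= 2 ->
  tri (~~ b) [set e; f; g] -> [set e; f; g] \subset S -> v \in S -> v != e -> x != e ->
  tri b [set x; e; v] -> x \notin S.
Proof.
move=> hS cS l t sS vS ve xe t'; apply/negP => xS.
have eS : e \in S by apply: (subsetP sS); rewrite !inE eqxx.
have sE := tangle_sub hT hS.
have e1 : e \in [set e; f; g] by rewrite !inE eqxx.
have e2 : e \in [set x; e; v] by rewrite !inE eqxx orbT.
have c1 : in_cl M (~~ b) (S :\ e) e.
  by apply: in_cl_mono (tri_in_cl hM h3 hE t e1) => //; apply: setSD.
have c2 : in_cl M b (S :\ e) e.
  by apply: in_cl_mono (tri_in_cl hM h3 hE t' e2) => //; apply: setSD; set_tac.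
have eE := subsetP sE _ eS.
have sD : S :\ e \subset E by set_tac.
have eD : e \notin S :\ e by rewrite !inE eqxx.
have := lambda_cl2 hM eE sD eD c2 c1; rewrite setD1K //.
by have := tangle_lambda_ge2 hS cS; nlia.
Qed.

(* [e1, ..., e5] is one end of a fan on [S], with [e1] outermost; removing [e1]
   means deletion if [e1 e2 e3] is a triangle and contraction if it is a triad,
   that is, removal of type [b]. *)
Definition fan_end S b e1 e2 e3 e4 e5 :=
  [/\ [set e1; e2; e3; e4; e5] \subset S, uniq [:: e1; e2; e3; e4; e5],
      tri (~~ b) [set e1; e2; e3], tri b [set e2; e3; e4] & tri (~~ b) [set e3; e4; e5]]
  /\ lam (S :\ e1) <= 2.

Lemma fan_end_setU1 b S b' d1 d2 d3 d4 d5 x Y : S \subset E -> x \in E -> x \notin S ->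
  Y \subset S :\ d1 -> in_cl M b Y x ->
  fan_end S b' d1 d2 d3 d4 d5 -> fan_end (x |: S) b' d1 d2 d3 d4 d5.
Proof.
move=> sS xE xS sY cY [[sd u t1 t2 t3] l]; split.
  by split=> //; apply: subset_trans sd (subsetU1 _ _).
have d1S : d1 \in S by apply: (subsetP sd); rewrite !inE eqxx.
have xd1 : x != d1 by apply: contraNneq xS => ->.
have -> : (x |: S) :\ d1 = x |: (S :\ d1) by set_tac.
apply: leq_trans l; apply: (lambda_cl hM xE); first by set_tac.
  by rewrite !inE negb_and xS orbT.
exact: in_cl_mono cY.
Qed.

Lemma tangle_in_cl_setU1 b S x Y : S \in Tg -> lam S <= 2 -> x \in E -> x \notin S ->
  Y \subset S -> in_cl M b Y x -> x |: S \in Tg /\ lam (x |: S) <= 2.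
Proof.
move=> hS lS xE xS sY cY.
have l : lam (x |: S) <= 2.
  apply: leq_trans lS; apply: (lambda_cl hM xE (tangle_sub hT hS) xS).
  exact: in_cl_mono cY.
by split=> //; apply: (tangle_setU1 hM hT) => //; nlia.
Qed.

(* The fan is extended at [e1]. At most one element of a fan is in [F], so if the
   new end is in [F] then the other end [d1] can take over for good. *)
Lemma stuck_fan_absurd n S b e1 e2 e3 e4 e5 b' d1 d2 d3 d4 d5 :
  #|E :\: S| <= n -> S \in Tg -> lam S <= 2 ->
  fan_end S b e1 e2 e3 e4 e5 -> fan_end S b' d1 d2 d3 d4 d5 ->
  d1 != e1 -> d1 != e2 -> e1 != d2 -> e1 \notin F -> Nrem b e1 ->
  S :&: F != set0 \/ (d1 \notin F /\ Nrem b' d1) -> False.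
Proof.
elim: n S b e1 e2 e3 e4 e5 b' d1 d2 d3 d4 d5 => [|n IH] S b e1 e2 e3 e4 e5 b' d1 d2 d3 d4 d5.
  by move=> cS hS; have := tangle_compl hM hT th2 hS; nlia.
move=> cS hS lS fe fd de1 de2 ed2 eF ne hor.
case: (fe) => -[se u t1 t2 t3] le; case: (fd) => -[sd _ _ _ _] _.
have sS := tangle_sub hT hS.
have u4 : uniq [:: e1; e2; e3; e4].
  have eu : [:: e1; e2; e3; e4; e5] = rcons [:: e1; e2; e3; e4] e5 by [].
  by move: u; rewrite eu rcons_uniq => /andP[].
have [x [v [vI tx xn]]] := fan_extend eF ne u4 t1 t2.
have e1S : e1 \in S by apply: (subsetP se); rewrite !inE eqxx.
have e2S : e2 \in S by apply: (subsetP se); rewrite !inE eqxx ?orbT.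
have e3S : e3 \in S by apply: (subsetP se); rewrite !inE eqxx ?orbT.
have e4S : e4 \in S by apply: (subsetP se); rewrite !inE eqxx ?orbT.
have e5S : e5 \in S by apply: (subsetP se); rewrite !inE eqxx ?orbT.
have d1S : d1 \in S by apply: (subsetP sd); rewrite !inE eqxx.
have d2S : d2 \in S by apply: (subsetP sd); rewrite !inE eqxx ?orbT.
move: (u); rewrite /= !inE !negb_or.
case/and5P => /and4P[u12 u13 u14 u15] /and3P[u23 u24 u25] /andP[u34 u35] u45 _.
have cS1 : 1 < #|S| by apply/card_gt1P; exists e1, e2.
have vS : v \in S by move: vI; rewrite !inE => /orP[] /eqP ->.
have ve : v != e1 by move: vI; rewrite !inE => /orP[] /eqP ->; rewrite eq_sym.
move: (xn); rewrite !inE !negb_or => /andP[/andP[xe1 xe2] xe3].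
have sT : [set e1; e2; e3] \subset S by set_tac.
have xS : x \notin S := fan_extend_new hS cS1 le t1 sT vS ve xe1 tx.
have xE : x \in E by case/triP: tx => /subsetP h _ _; apply: h; rewrite !inE eqxx.
have xne z : z \in S -> x != z by move=> zS; apply: contraNneq xS => ->.
(* If v were e3, then {x, e1, e3} and {e3, e4, e5}, of opposite types, would meet in e3 alone. This
   is the use of the fifth element. *)
have ev : v = e2.
  move: vI; rewrite !inE => /orP[/eqP //|/eqP ev]; exfalso; rewrite ev in tx.
  have e3x : e3 \in [set x; e1; e3] by rewrite !inE eqxx orbT.
  have e3y : e3 \in [set e3; e4; e5] by rewrite !inE eqxx.
  have := tri_meet hM h3 hE tx t3 e3x e3y.
  have -> : [set x; e1; e3] :&: [set e3; e4; e5] = [set e3].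
    apply/setP => z; rewrite !inE.
    have [->|z3] := eqVneq z e3; first by rewrite orbT.
    rewrite orbF /=; have [->|zx] := eqVneq z x.
      by rewrite (negbTE (xne _ e4S)) (negbTE (xne _ e5S)).
    by have [->|] := eqVneq z e1; rewrite ?(negbTE u14) ?(negbTE u15).
  by rewrite cards1.
subst v => {vI vS ve}.
have clx : in_cl M b [set e1; e2] x.
  have xI : x \in [set x; e1; e2] by rewrite !inE eqxx.
  by apply: in_cl_mono (tri_in_cl hM h3 hE tx xI) => //; set_tac.
have s12 : [set e1; e2] \subset S by set_tac.
have s12d : [set e1; e2] \subset S :\ d1.
  by apply/subsetP => z; rewrite !inE => /orP[] /eqP ->; rewrite ?e1S ?e2S eq_sym ?de1 ?de2.
have [hS' lS'] := tangle_in_cl_setU1 hS lS xE xS s12 clx.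
have fd' := fan_end_setU1 sS xE xS s12d clx fd.
have fx : fan_end (x |: S) (~~ b) x e1 e2 e3 e4.
  split; last by rewrite setU1K.
  rewrite negbK; split=> //; first by set_tac.
  by rewrite cons_uniq u4 !inE !negb_or !xne.
have cS' : #|E :\: (x |: S)| <= n.
  have := cardsD1 x (E :\: S); rewrite inE xS xE.
  have -> : (E :\: S) :\ x = E :\: (x |: S) by set_tac.
  by nlia.
have xd1 : x != d1 := xne _ d1S; have xd2 : x != d2 := xne _ d2S.
(* If x avoids F, the growth goes on at x, which [Nrem_tri] makes removable in the opposite type. *)
have [xF|xF] := boolP (x \in F); last first.
  apply: (IH _ _ _ _ _ _ _ _ _ _ _ _ _ cS' hS' lS' fx fd') => //.
  - by rewrite eq_sym.
  - by apply: Nrem_tri tx _ _ xe1 xF ne; rewrite !inE eqxx ?orbT.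
  - case: hor => [/set0Pn[z hz]|]; [left | by right].
    by move: hz; rewrite inE => /andP[zS zF]; apply/set0Pn; exists z; rewrite !inE zS zF orbT.
have c1 : #|(x |: S) :&: F| <= 1.
  by apply: card_capF hS' lS' _ eF; rewrite !inE e1S orbT.
have xI : x \in (x |: S) :&: F by rewrite !inE eqxx.
(* If x is in F, either S already met F and there are now two elements in F, or d1 is available and
   the two ends exchange roles. *)
case: hor => [/set0Pn[z]|[dF nd]].
  rewrite inE => /andP[zS zF].
  have : 1 < #|(x |: S) :&: F|.
    by apply/card_gt1P; exists x, z; rewrite xI !inE zS zF orbT; split=> //; apply: xne.
  by nlia.
apply: (IH _ _ _ _ _ _ _ _ _ _ _ _ _ cS' hS' lS' fd' fx) => //.
by left; apply/set0Pn; exists x.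
Qed.

(** One extension at [x1] gives a five-element fan, to which [stuck_fan_absurd] applies. *)
Lemma stuck_fan4_absurd b x1 x2 x3 x4 : uniq [:: x1; x2; x3; x4] ->
  tri b [set x1; x2; x3] -> tri (~~ b) [set x2; x3; x4] ->
  x1 \notin F -> Nrem (~~ b) x1 ->
  [set x1; x2; x3; x4] :&: F != set0 \/ (x4 \notin F /\ Nrem b x4) -> False.
Proof.
move=> u t t' x1F n1 hor; have [hS lS] := fan_tangle u t t'.
set S := [set x1; x2; x3; x4] in hS lS hor *.
have tn : tri (~~ ~~ b) [set x1; x2; x3] by rewrite negbK.
have [x [v [vI tx xn]]] := fan_extend x1F n1 u tn t'.
move: (u); rewrite /= !inE !negb_or.
case/and4P => /and3P[u12 u13 u14] /andP[u23 u24] u34 _.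
have sS := tangle_sub hT hS.
have x1S : x1 \in S by rewrite !inE eqxx.
have x2S : x2 \in S by rewrite !inE eqxx ?orbT.
have x3S : x3 \in S by rewrite !inE eqxx ?orbT.
have x4S : x4 \in S by rewrite !inE eqxx ?orbT.
have cS1 : 1 < #|S| by apply/card_gt1P; exists x1, x2.
(* The two middle elements of a four-element fan are interchangeable, so the new fan is ordered x,
   x1, v, w, x4. *)
have [w ew] : exists w, [set v; w] = [set x2; x3].
  by move: vI; rewrite !inE => /orP[] /eqP ->; [exists x3 | exists x2; rewrite setUC].
have vw : v != w.
  by have := cards2 x2 x3; rewrite u23 -ew cards2; case: (v != w).
have wI : w \in [set x2; x3] by rewrite -ew !inE eqxx orbT.
have sub23 z : z \in [set x2; x3] -> [/\ z \in S, x1 != z & z != x4].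
  by rewrite in_set2 => /orP[] /eqP ->.
have [vS v1 v4] := sub23 _ vI; have [wS w1 w4] := sub23 _ wI.
have t1 : tri b [set x1; v; w] by rewrite -setUA ew setUA.
have t2 : tri (~~ b) [set v; w; x4] by rewrite ew.
have lD : lam (S :\ x1) <= 2.
  have -> : S :\ x1 = [set v; w; x4].
    rewrite ew /S -!setUA setU1K ?setUA // !inE !negb_or u12 u13 u14 //.
  by rewrite (tri_lambda hM h3 hE t2).
have xx1 : x != x1 by move: xn; rewrite !inE !negb_or => /andP[/andP[]].
have sT : [set x1; x2; x3] \subset S by set_tac.
have v1' : v != x1 by rewrite eq_sym.
have eS : S = [set x1; x2; x3; x4] by [].
clearbody S.
have xS : x \notin S := fan_extend_new hS cS1 lD tn sT vS v1' xx1 tx.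
have xE : x \in E by case/triP: tx => /subsetP h _ _; apply: h; rewrite !inE eqxx.
have xne z : z \in S -> x != z by move=> zS; apply: contraNneq xS => ->.
have clx : in_cl M (~~ b) [set x1; v] x.
  have xI : x \in [set x; x1; v] by rewrite !inE eqxx.
  by apply: in_cl_mono (tri_in_cl hM h3 hE tx xI) => //; set_tac.
have s12 : [set x1; v] \subset S by apply/subsetP => z; rewrite in_set2 => /orP[] /eqP ->.
have lS2 : lam S <= 2 by rewrite lS.
have [hS' lS'] := tangle_in_cl_setU1 hS lS2 xE xS s12 clx.
have fx : fan_end (x |: S) b x x1 v w x4.
  split; last by rewrite setU1K.
  split=> //; first by set_tac.
  by rewrite /= !inE !negb_or !xne //= v1 w1 u14 vw v4 w4.
have s4 : [set x1; v; w] \subset E by case/triP: t1.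
have x4w : x4 != w by rewrite eq_sym.
have x4v : x4 != v by rewrite eq_sym.
have f4 : fan_end (x |: S) b x4 w v x1 x.
  have ew3 : [set x4; w; v] = [set v; w; x4] by set_tac.
  have ew1 : [set w; v; x1] = [set x1; v; w] by set_tac.
  have evx : [set v; x1; x] = [set x; x1; v] by set_tac.
  split; first split; rewrite ?ew3 ?ew1 ?evx //.
  - by set_tac.
  - rewrite /= !inE !negb_or x4w x4v ![_ == x]eq_sym !xne // [w == v]eq_sym vw.
    by rewrite ![_ == x1]eq_sym u14 w1 v1.
  have eD : (x |: S) :\ x4 = x |: [set x1; v; w].
    rewrite eS; have -> : [set x1; v; w] = [set x1; x2; x3] by rewrite -setUA ew setUA.
    have x4x : x4 != x by rewrite eq_sym xne.
    by set_tac.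
  rewrite eD -(tri_lambda hM h3 hE t1); apply: (lambda_cl hM xE s4).
    by rewrite !inE !negb_or !xne.
  by apply: in_cl_mono clx => //; set_tac.
have xI : x \in F -> x \in (x |: S) :&: F by rewrite !inE eqxx.
have x4x : x4 != x by rewrite eq_sym xne.
have x41 : x4 != x1 by rewrite eq_sym.
have xw : x != w := xne _ wS.
have [xF|xF] := boolP (x \in F); last first.
  apply: (stuck_fan_absurd (leqnn _) hS' lS' fx f4) => //.
  - rewrite -[b]negbK; apply: Nrem_tri tx _ _ xx1 xF n1; by rewrite !inE eqxx ?orbT.
  - case: hor => [/set0Pn[z hz]|]; [left | by right].
    by move: hz; rewrite inE => /andP[zS zF]; apply/set0Pn; exists z; rewrite !inE zS zF orbT.
case: hor => [/set0Pn[z hz]|[x4F n4]].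
  move: hz; rewrite inE => /andP[zS zF].
  have : #|(x |: S) :&: F| <= 1.
    by apply: card_capF hS' lS' _ x1F; rewrite inE x1S orbT.
  have : 1 < #|(x |: S) :&: F|.
    apply/card_gt1P; exists x, z; rewrite xI // !inE zF zS orbT; split=> //.
    exact: xne.
  by nlia.
apply: (stuck_fan_absurd (leqnn _) hS' lS' f4 fx) => //.
- by rewrite eq_sym.
- by left; apply/set0Pn; exists x; apply: xI.
Qed.

Lemma stuck_absurd : False.
Proof.
have [b [x1 [x2 [x3 [x4 [u t t' cF]]]]]] := stuck_has_fan.
case/triP: (t) => sS _ _; case/triP: (t') => sS' _ _.
have x2E : x2 \in E by apply: (subsetP sS); rewrite !inE eqxx ?orbT.
have x3E : x3 \in E by apply: (subsetP sS); rewrite !inE eqxx ?orbT.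
move: (u); rewrite /= !inE !negb_or.
case/and4P => /and3P[u12 u13 u14] /andP[u23 u24] u34 _.
(* An end is good if growth can start there. One good end is enough if the fan meets F; otherwise
   both are required. *)
pose g1 := x1 \notin F /\ Nrem (~~ b) x1; pose g4 := x4 \notin F /\ Nrem b x4.
have ur : uniq [:: x4; x3; x2; x1] by have := rev_uniq [:: x1; x2; x3; x4]; rewrite u.
have tr : tri (~~ b) [set x4; x3; x2].
  by have -> : [set x4; x3; x2] = [set x2; x3; x4] by set_tac.
have tr' : tri (~~ ~~ b) [set x3; x2; x1].
  by rewrite negbK; have -> : [set x3; x2; x1] = [set x1; x2; x3] by set_tac.
set S := [set x1; x2; x3; x4] in cF *.
have eS : [set x4; x3; x2; x1] = S by rewrite /S; set_tac.
have fin : S :&: F != set0 /\ (g1 \/ g4) \/ (g1 /\ g4) -> False.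
  have f1 : g1 -> S :&: F != set0 \/ g4 -> False.
    by case=> h1 h2; apply: (stuck_fan4_absurd u t t' h1 h2).
  have f4 : g4 -> S :&: F != set0 \/ g1 -> False.
    case=> h1 h2 h; apply: (stuck_fan4_absurd ur tr tr' h1); first by rewrite negbK.
    by rewrite eS.
  case=> [[h [hg|hg]]|[hg1 hg4]]; first by apply: (f1 hg); left.
    by apply: (f4 hg); left.
  by apply: (f1 hg1); right.
have S1 : x1 \in S by rewrite !inE eqxx.
have S2 : x2 \in S by rewrite !inE eqxx ?orbT.
have S3 : x3 \in S by rewrite !inE eqxx ?orbT.
have S4 : x4 \in S by rewrite !inE eqxx ?orbT.
have one y z : y \in S -> z \in S -> y != z -> y \in F -> z \notin F.
  move=> yS zS yz yF; apply/negP => zF.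
  have : 1 < #|S :&: F| by apply/card_gt1P; exists y, z; rewrite !in_setI yS zS yF zF.
  by nlia.
have meets y : y \in S -> y \in F -> S :&: F != set0.
  by move=> yS yF; apply/set0Pn; exists y; rewrite in_setI yS.
(* A middle element removable in type b makes x1 good; one removable in the other type makes x4
   good. *)
have i1 y : y \in [set x2; x3] -> Nrem b y -> x1 \notin F -> g1.
  move=> yI ny h1; split=> //; apply: (Nrem_tri t _ _ _ h1 ny).
  - by move: yI; rewrite !inE => /orP[] ->; rewrite ?orbT.
  - by rewrite !inE eqxx.
  - by move: yI; rewrite !inE => /orP[] /eqP ->.
have i4 y : y \in [set x2; x3] -> Nrem (~~ b) y -> x4 \notin F -> g4.
  move=> yI ny h1; split=> //; rewrite -[b]negbK; apply: (Nrem_tri t' _ _ _ h1 ny).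
  - by move: yI; rewrite !inE => /orP[] ->; rewrite ?orbT.
  - by rewrite !inE eqxx ?orbT.
  - by move: yI; rewrite !inE => /orP[] /eqP ->; rewrite eq_sym.
have I2 : x2 \in [set x2; x3] by rewrite !inE eqxx.
have I3 : x3 \in [set x2; x3] by rewrite !inE eqxx orbT.
have ty y : y \in E -> y \notin F -> Nrem b y \/ Nrem (~~ b) y.
  move=> yE yF; have [b' nb] := Nrem_or yE yF.
  by case: (b') (b) nb => -[]; [left|right|right|left].
have [x2F|x2F] := boolP (x2 \in F).
  have x3F := one _ _ S2 S3 u23 x2F; have x4F := one _ _ S2 S4 u24 x2F.
  have x1F : x1 \notin F by apply: (one _ _ S2 S1 _ x2F); rewrite eq_sym.
  apply: fin; left; split; first exact: meets S2 x2F.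
  by case: (ty _ x3E x3F) => h; [left; apply: i1 I3 h x1F | right; apply: i4 I3 h x4F].
have [x3F|x3F] := boolP (x3 \in F).
  have x4F := one _ _ S3 S4 u34 x3F.
  have x1F : x1 \notin F by apply: (one _ _ S3 S1 _ x3F); rewrite eq_sym.
  apply: fin; left; split; first exact: meets S3 x3F.
  by case: (ty _ x2E x2F) => h; [left; apply: i1 I2 h x1F | right; apply: i4 I2 h x4F].
(* With both x2 and x3 outside F, [Nrem_tri] passes from x2 to x3 with the type reversed, so each
   type occurs in the middle and serves its end. *)
have good1 : x1 \notin F -> g1.
  move=> x1F; case: (ty _ x2E x2F) => h; first exact: i1 I2 h x1F.
  apply: (i1 _ I3 _ x1F); rewrite -[b]negbK.
  by apply: Nrem_tri t' _ _ _ x3F h; rewrite ?inE ?eqxx ?orbT // eq_sym.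
have good4 : x4 \notin F -> g4.
  move=> x4F; case: (ty _ x2E x2F) => h; last exact: i4 I2 h x4F.
  apply: (i4 _ I3 _ x4F).
  by apply: Nrem_tri t _ _ _ x3F h; rewrite ?inE ?eqxx ?orbT // eq_sym.
have [x1F|x1F] := boolP (x1 \in F).
  have x4F := one _ _ S1 S4 u14 x1F.
  by apply: fin; left; split; [exact: meets S1 x1F | right; apply: good4].
have [x4F|x4F] := boolP (x4 \in F); last first.
  by apply: fin; right; split; [apply: good1 | apply: good4].
by apply: fin; left; split; [exact: meets S4 x4F | left; apply: good1].
Qed.

End Stuck.

(** * Minors and the ways to obtain N *)

Section Minors.
Variable T : finType.
Implicit Types (M N : matroid T) (X Y Z A B C D S : {set T}) (e a x y : T) (b : bool).

Lemma matroid_axioms_minor M C D : matroid_axioms M -> C \subset ground M ->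
  matroid_axioms (minor_of M C D).
Proof.
move=> hM sC; have sG X : X \subset ground M :\: (C :|: D) -> X :|: C \subset ground M.
  by move=> sX; set_tac.
have le X : X \subset ground M :\: (C :|: D) -> rk M C <= rk M (X :|: C).
  by move=> sX; apply: rk_mono => //; [apply: subsetUr | apply: sG].
split=> /= [X sX|X Y sXY sY|X Y sX sY].
- have sX' : X \subset ground M by set_tac.
  by have := rk_setU hM sC sX'; rewrite setUC; nlia.
- have := rk_mono hM (setSU C sXY) (sG _ sY); nlia.
- have := rk_submod hM (sG _ sX) (sG _ sY).
  have -> : (X :|: C) :|: (Y :|: C) = X :|: Y :|: C by set_tac.
  have -> : (X :|: C) :&: (Y :|: C) = (X :&: Y) :|: C by set_tac.
  have sU : X :|: Y \subset ground M :\: (C :|: D) by rewrite subUset sX.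
  have sI : X :&: Y \subset ground M :\: (C :|: D) by apply: subset_trans (subsetIl _ _) sX.
  by have := le _ sX; have := le _ sY; have := le _ sU; have := le _ sI; nlia.
Qed.

Lemma matroid_axioms_eq M N : matroid_eq M N -> matroid_axioms N -> matroid_axioms M.
Proof.
move=> [eG eR] [h1 h2 h3]; split=> [X sX|X Y sXY sY|X Y sX sY].
- by rewrite eR //; apply: h1; rewrite -eG.
- rewrite !eR //; first by apply: h2; rewrite -?eG.
  exact: subset_trans sY.
- have sU : X :|: Y \subset ground M by rewrite subUset sX.
  have sI : X :&: Y \subset ground M by apply: subset_trans (subsetIl _ _) sX.
  by rewrite !eR //; apply: h3; rewrite -eG.
Qed.

Lemma has_minor_axioms M N : matroid_axioms M -> has_minor M N -> matroid_axioms N.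
Proof.
by move=> hM [C [D [sC _ _ e]]]; apply: (matroid_axioms_eq e); apply: matroid_axioms_minor.
Qed.

Lemma has_minor_sub M N : has_minor M N -> ground N \subset ground M.
Proof. by case=> C [D [_ _ _ [-> _]]]; apply: subsetDl. Qed.

Section Removal.
Variables (M N : matroid T).
Hypotheses (hM : matroid_axioms M) (hMN : has_minor M N).
Local Notation E := (ground M).
Local Notation G := (ground N).

(* [N = M / C \ D] if [b] is true, and [N = M / D \ C] if [b] is false. *)
Definition minor_pair b C D := [&& C :|: D == E :\: G, C \subset ~: D &
  [forall X : {set T}, (X \subset G) ==> (rkb N b X + rkb M b C == rkb M b (X :|: C))]].

Lemma minor_pairP b C D : reflect
  [/\ C :|: D = E :\: G, C \subset ~: D &
      forall X, X \subset G -> rkb N b X + rkb M b C = rkb M b (X :|: C)]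
  (minor_pair b C D).
Proof.
apply: (iffP and3P) => [[/eqP h1 h2 /forallP h3]|[h1 h2 h3]]; split=> //.
- by move=> X sX; apply/eqP; have := h3 X; rewrite sX.
- by apply/eqP.
- by apply/forallP => X; apply/implyP => sX; apply/eqP; apply: h3.
Qed.

Lemma minor_pair_exists : exists C D, minor_pair true C D.
Proof.
case: hMN => C [D [sC sD dCD [eG eR]]]; exists C, D; apply/minor_pairP.
rewrite disjoints_subset in dCD; split=> //.
  by rewrite eG /=; set_tac.
move=> X sX; rewrite /rkb; have eX : X :&: G = X by apply/setIidPl.
have sX' : X \subset E by apply: subset_trans sX (has_minor_sub hMN).
rewrite eX (setIidPl sC) eR //= (_ : (X :|: C) :&: E = X :|: C); last by set_tac.
have sXC : X :|: C \subset E by set_tac.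
by have := rk_mono hM (subsetUr X C) sXC; nlia.
Qed.

(** Duality exchanges contraction and deletion: [rkb_dual] in N and in M reduces the claim at [X] to
    the hypothesis at the ground set of N and at its part outside [X]. *)
Lemma minor_pair_dual b C D : minor_pair b C D -> minor_pair (~~ b) D C.
Proof.
case/minor_pairP => eCD dCD h; apply/minor_pairP; split.
- by rewrite setUC.
- by set_tac.
move=> X sX; have hN := has_minor_axioms hM hMN; have sG := has_minor_sub hMN.
have mem z : (z \in C) || (z \in D) = (z \in E) && (z \notin G).
  by have /setP/(_ z) := eCD; rewrite !inE andbC.
have sD : D \subset E.
  by apply/subsetP => z zD; have := mem z; rewrite zD orbT => /esym/andP[].
have sXD : X :|: D \subset E by rewrite subUset sD (subset_trans sX sG).
have cXD : #|X :|: D| = #|X| + #|D|.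
  apply/eqP; rewrite (leq_card_setU X D).2 disjoints_subset; apply/subsetP => z zX.
  rewrite inE; apply/negP => zD; have := mem z; rewrite zD orbT => /esym/andP[_ /negP].
  by apply; apply: (subsetP sX).
have e1 : E :\: D = G :|: C.
  apply/setP => z; rewrite !inE; have := mem z.
  move: (introT implyP (subsetP sG z)) (introT implyP (subsetP dCD z)); rewrite inE.
  by case: (z \in E); case: (z \in G); case: (z \in C); case: (z \in D).
have e2 : E :\: (X :|: D) = (G :\: X) :|: C.
  have -> : E :\: (X :|: D) = (E :\: D) :\: X by set_tac.
  rewrite e1; apply/setP => z; rewrite !inE; have := mem z.
  move: (introT implyP (subsetP sX z)).
  by case: (z \in X); case: (z \in G); case: (z \in C); case: (z \in E).
have := rkb_dual hN b sX; have := rkb_dual hM b sD; have := rkb_dual hM b sXD.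
rewrite e1 e2 cXD; have := h G (subxx _); have := h (G :\: X) (subsetDl _ _).
by nlia.
Qed.

(** The instance used for [Nrem]. The pair is not fixed, so one element may be removable in both
    types. *)
Definition removable b e := [exists C : {set T}, exists D : {set T},
  minor_pair b C D && (e \in C)].

Lemma removableP b e : reflect (exists C D, minor_pair b C D /\ e \in C) (removable b e).
Proof.
apply: (iffP existsP) => [[C /existsP[D /andP[h1 h2]]]|[C [D [h1 h2]]]].
  by exists C, D.
by exists C; apply/existsP; exists D; rewrite h1.
Qed.

Lemma removable_or e : e \in E -> e \notin G -> exists b, removable b e.
Proof.
move=> eE eG; have [C [D h]] := minor_pair_exists.
case/minor_pairP: (h) => /setP/(_ e); rewrite !inE eE eG => /orP[eC|eD] _ _.
  by exists true; apply/removableP; exists C, D.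
exists false; apply/removableP; exists D, C; split=> //; exact: (minor_pair_dual h).
Qed.

Hypotheses (hl : no_loops N) (hc : no_coloops N).

Lemma rkb_no_loops b y : y \in G -> 0 < rkb N b [set y].
Proof.
move=> yG; have s1 : [set y] \subset G by rewrite sub1set.
case: b; rewrite /rkb (setIidPl s1).
  by have := hl y; rewrite /is_loop yG lt0n.
by have := hc y; rewrite /is_coloop yG /= cards1 -leqNgt; nlia.
Qed.

(* In [M / e] the other two elements of a triangle through [e] are parallel,
   so they are interchangeable unless [N] uses one of them. *)
Lemma removable_tri b S e a : three_connected M -> 4 < #|E| -> tri M b S ->
  e \in S -> a \in S -> a != e -> a \notin G -> removable b e -> removable (~~ b) a.
Proof.
move=> h3 hE t eS aS ae aG /removableP[C [D [h eC]]].
case/triP: (t) => sS cS _.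
case/minor_pairP: (h) => eCD dCD hr.
have sG := has_minor_sub hMN.
have mem z : (z \in C) || (z \in D) = (z \in E) && (z \notin G).
  by have /setP/(_ z) := eCD; rewrite !inE andbC.
have := mem a; rewrite aG (subsetP sS) // => /orP[aC|aD]; last first.
  by apply/removableP; exists D, C; split=> //; apply: minor_pair_dual.
have /cards1P[y ey] : #|(S :\ e) :\ a| == 1.
  apply/eqP; have := cardsD1 e S; have := cardsD1 a (S :\ e).
  by rewrite !inE ae aS eS cS; nlia.
have : y \in (S :\ e) :\ a by rewrite ey inE.
rewrite !inE => /and3P[ya ye yS].
have eSS : S = [set e; a; y].
  by rewrite -[LHS](setD1K eS) -(setD1K (_ : a \in S :\ e)) ?ey ?setUA // !inE ae.
have yE := subsetP sS _ yS.
have ey' : e != y by rewrite eq_sym.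
have ay : a != y by rewrite eq_sym.
have clS z : z \in S -> in_cl M b (S :\ z) z by apply: (tri_in_cl hM h3 hE t).
have cly Z : in_cl M b (Z :|: C) y.
  by apply: in_cl_mono (clS y yS) => //; rewrite eSS; set_tac.
(* With e and a both in C, the set C spans y, so y would be a loop or a coloop of N. *)
have yG : y \notin G.
  apply/negP => yG; have s1 : [set y] \subset G by rewrite sub1set.
  have := hr _ s1; have := cly set0; rewrite set0U => /eqP ->.
  by have := rkb_no_loops b yG; nlia.
have := mem y; rewrite yG yE => yCD.
(* Since e stays in the set, C and C' span each other; the definition covers both y in C and y in
   D. *)
set C' := y |: (C :\ a); set D' := a |: (D :\ y).
have ea : e != a by rewrite eq_sym.
have eC' : e \in C' by rewrite !inE eC ea orbT.
have yC' : y \in C' by rewrite !inE eqxx.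
have cla Z : in_cl M b (Z :|: C') a.
  apply: in_cl_mono (clS a aS) => //; rewrite eSS.
  by clearbody C'; set_tac.
have rCC Z : rkb M b (Z :|: C') = rkb M b (Z :|: C).
  rewrite -(eqP (cla Z)) -(eqP (cly Z)); congr (rkb M b _).
  by rewrite /C'; set_tac.
have h' : minor_pair b C' D'.
  apply/minor_pairP; split.
  - rewrite -eCD; apply/setP => z; rewrite !inE.
    have [->|za] := eqVneq z a; first by rewrite aC orbT.
    have [->|zy] := eqVneq z y; first by rewrite yCD.
    by [].
  - apply/subsetP => z; move: (subsetP dCD z); rewrite !inE => hz.
    have [->|zy] := eqVneq z y; first by rewrite orbF /= eq_sym ay.
    by rewrite /= => /andP[za zC]; rewrite (negbTE za) /=; apply: hz.
  - by move=> X sX; rewrite rCC -hr // -[C']set0U -[C in RHS]set0U rCC.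
apply/removableP; exists D', C'; split; first exact: minor_pair_dual.
by rewrite !inE eqxx.
Qed.

End Removal.

(** * Removing a single element *)

Definition removal M b e :=
  if b then minor_of M [set e] set0 else minor_of M set0 [set e].

Lemma ground_removal M b e : ground (removal M b e) = ground M :\ e.
Proof. by case: b; rewrite /removal /= ?setU0 ?set0U. Qed.

Lemma has_minor_removal M N b e : matroid_axioms M -> has_minor M N ->
  removable M N b e -> has_minor (removal M b e) N.
Proof.
move=> hM hMN /removableP[C [D [h eC]]].
have sG := has_minor_sub hMN.
have [C1 [D1 [h1 e1]]] : exists C1 D1, minor_pair M N true C1 D1 /\
    (e \in if b then C1 else D1).
  case: b h => [|] h; first by exists C, D.
  by exists D, C; split=> //; apply: (minor_pair_dual hM hMN h).
case/minor_pairP: h1 => eCD dCD hr.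
have sC : C1 \subset ground M.
  by apply: subset_trans (subsetDl _ (ground N)); rewrite -eCD subsetUl.
have sD : D1 \subset ground M.
  by apply: subset_trans (subsetDl _ (ground N)); rewrite -eCD subsetUr.
have rN X : X \subset ground N -> rk N X + rk M C1 = rk M (X :|: C1).
  move=> sX; have := hr X sX; rewrite /rkb (setIidPl sX) (setIidPl sC) => ->.
  by rewrite (setIidPl _) // subUset sC (subset_trans sX sG).
have eN : ground N = ground M :\: (C1 :|: D1) by rewrite eCD; set_tac.
case: b h e1 => _ e1.
  exists (C1 :\ e), D1; split.
  - by rewrite ground_removal; apply: setSD.
  - rewrite ground_removal; apply/subsetP => z zD; rewrite !inE (subsetP sD) // andbT.
    by apply: contraTneq zD => ->; have := subsetP dCD _ e1; rewrite inE.
  - by rewrite disjoints_subset; set_tac.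
  split; first by rewrite /= eN; set_tac.
  move=> X sX /=; have e2 : C1 :\ e :|: [set e] = C1 by set_tac.
  rewrite -setUA e2; have := rN X sX.
  have s1 : [set e] \subset C1 by rewrite sub1set.
  have s2 : C1 \subset X :|: C1 by apply: subsetUr.
  have s3 : X :|: C1 \subset ground M by rewrite subUset sC (subset_trans sX sG).
  by have := rk_mono hM s1 sC; have := rk_mono hM s2 s3; nlia.
exists C1, (D1 :\ e); split.
- rewrite ground_removal; apply/subsetP => z zC; rewrite !inE (subsetP sC) // andbT.
  by apply: contraTneq zC => ->; apply/negP => /(subsetP dCD); rewrite inE e1.
- by rewrite ground_removal; apply: setSD.
- by rewrite disjoints_subset; set_tac.
split; first by rewrite /= eN; set_tac.
by move=> X sX /=; rewrite !setU0 rk0 // !subn0 -rN //; nlia.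
Qed.

(** Connectivity 1 makes [e] neither a loop nor a coloop, so its rank and corank are 1. This fixes
    the constant. *)
Lemma lambda_removal M b e X : matroid_axioms M -> e \in ground M ->
  lambda M [set e] = 1 -> X \subset ground M :\ e ->
  lambda (removal M b e) X + 1 + rkb M b (ground M) =
  rkb M b (e |: X) + rkb M b (ground M :\: X).
Proof.
move=> hM eE le sX; set E := ground M.
have s1 : [set e] \subset E by rewrite sub1set.
have sX' : X \subset E by set_tac.
have eX : e \notin X by apply/negP => /(subsetP sX); rewrite !inE eqxx.
have sX1 : e |: X \subset E by set_tac.
have r1 : forall b, rkb M b [set e] = 1.
  move=> b'; have := lambda_card hM b' s1; rewrite le cards1.
  have := rkb_card hM b' [set e]; have := rkb_card hM (~~ b') [set e]; rewrite cards1; nlia.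
have eD : E :\ e :\: X = E :\: (e |: X) by set_tac.
case: b; rewrite /lambda /rank ground_removal /= -/E.
  have := r1 true; rewrite /rkb (setIidPl s1) setIid (setIidPl sX1) => re.
  have -> : (E :\: X) :&: E = E :\: X by set_tac.
  rewrite re eD; have -> : X :|: [set e] = e |: X by rewrite setUC.
  have -> : E :\: (e |: X) :|: [set e] = E :\: X by set_tac.
  have -> : E :\ e :|: [set e] = E by set_tac.
  have := rk_submod hM sX1 (subsetDl E X).
  have -> : e |: X :|: (E :\: X) = E by set_tac.
  have -> : (e |: X) :&: (E :\: X) = [set e] by set_tac.
  rewrite re; have := rk_mono hM s1 (subxx _); rewrite re.
  have s2 : [set e] \subset e |: X by set_tac.
  have s3 : [set e] \subset E :\: X by set_tac.
  have := rk_mono hM s2 sX1; have := rk_mono hM s3 (subsetDl _ _); rewrite re -/E; nlia.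
rewrite !setU0 rk0 // !subn0 eD.
have := rkb_dual hM true s1; have := rkb_dual hM true sX1.
have := rkb_dual hM true (subsetDl E X); have := rkb_dual hM true (subxx E).
have -> : E :\: (E :\: X) = X by set_tac.
change (~~ true) with false; rewrite (r1 false) cards1 cardsU1 eX setDv -/E.
have rT Y : Y \subset E -> rkb M true Y = rk M Y by move=> sY; rewrite /rkb (setIidPl sY).
rewrite !rT ?subsetDl ?sub0set // rk0 //.
have := rk_submod hM sX' (subsetDl E (e |: X)).
have -> : X :|: (E :\: (e |: X)) = E :\ e by set_tac.
by have := card_compl sX'; have := subset_leq_card sX'; rewrite -/E; nlia.
Qed.

Lemma lambda_set1 M e : matroid_axioms M -> three_connected M -> 4 < #|ground M| ->
  e \in ground M -> lambda M [set e] = 1.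
Proof.
move=> hM h3 hE eE; have s1 : [set e] \subset ground M by rewrite sub1set.
have := h3 [set e] 1 s1 isT; rewrite card_compl // cards1 => /(_ isT).
have h : 0 < #|ground M| - 1 by nlia.
by move=> /(_ h); have := lambda_leq_card hM s1; rewrite cards1; nlia.
Qed.

(** A violating partition of the ground set without [e] must have k = 2. Its two sides, with or
    without [e], have connectivity 2 in M, so they form a separation at [e], and the tangle contains
    one of them. *)
Lemma three_connected_removal M Tg th b e : matroid_axioms M -> three_connected M ->
  is_tangle M Tg th -> 2 < th -> e \in ground M ->
  (forall A, A \in Tg -> ~~ sep_at M b e A) -> three_connected (removal M b e).
Proof.
move=> hM h3 hT th2 eE nosep X k; rewrite ground_removal => sX /andP[k0 k3] c1 c2.
set E := ground M in eE sX c2 *.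
have hE := tangle_card_ground hM hT th2.
have le := lambda_set1 hM h3 hE eE.
rewrite -/E in hE; have lr := lambda_removal b hM eE le sX; rewrite -/E in lr.
have sX' : X \subset E by set_tac.
have eX : e \notin X by apply/negP => /(subsetP sX); rewrite !inE eqxx.
have sX1 : e |: X \subset E by set_tac.
have eD : E :\ e :\: X = E :\: (e |: X) by set_tac.
rewrite eD in c2.
have cE := card_compl sX'; have cE1 := card_compl sX1; rewrite -/E in cE cE1.
have cX1 : #|e |: X| = #|X|.+1 by rewrite cardsU1 eX.
have lX := lambdaE hM b sX'; have lX1 := lambdaE hM b sX1; rewrite -/E in lX lX1.
have m1 := rkb_mono hM b (subsetU1 e X).
have sD : E :\: (e |: X) \subset E :\: X by set_tac.
have m2 := rkb_mono hM b sD.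
rewrite leqNgt; apply/negP => lk.
have g1 : 1 < lambda M (e |: X) \/ #|E :\: (e |: X)| = 1.
  case: (ltnP 1 #|E :\: (e |: X)|) => h; last by right; nlia.
  by left; apply: (lambda_ge2 h3) => //; nlia.
have g2 : 1 < lambda M X \/ #|X| = 1.
  case: (ltnP 1 #|X|) => h; last by right; nlia.
  by left; apply: (lambda_ge2 h3) => //; rewrite -/E; nlia.
have g3 : 1 < lambda M X \/ 1 < lambda M (e |: X).
  case: (ltnP 1 #|X|) => h.
    by left; apply: (lambda_ge2 h3) => //; rewrite -/E; nlia.
  by right; apply: (lambda_ge2 h3) => //; rewrite -/E; nlia.
have [k2 l1] : k = 2 /\ lambda (removal M b e) X = 1 by nlia.
have cX2 : 1 < #|X| by nlia.
have cD2 : 1 < #|E :\: (e |: X)| by nlia.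
have sp : sep_at M b e X.
  by apply/sep_atP; rewrite /in_cl; do !split=> //; [| |apply/eqP]; nlia.
have th1 : 1 < th by nlia.
case/sep_atP: (sp) => _ [lX2 lX12 _].
have lth : lambda M X < th by nlia.
case: (tangle_orC hT sX' lth) => hX; first by have := nosep _ hX; rewrite sp.
have lth1 : lambda M (e |: X) < th by nlia.
have hD : E :\: (e |: X) \in Tg.
  apply: (tangle_subset hT sD hX); rewrite lambdaC //.
by have := nosep _ hD; rewrite (sep_at_compl hM sp cD2).
Qed.

(** If each removal that keeps N were blocked, [stuck_absurd] would apply with [removable] as
    [Nrem]. *)
Lemma removable_exists M N Tg th (F : {set T}) : matroid_axioms M -> three_connected M ->
  is_tangle M Tg th -> 2 < th -> has_minor M N -> no_loops N -> no_coloops N ->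
  ground N \subset F -> F \in Tg ->
  (forall A, A \in Tg -> lambda M (A :|: F) <= lambda M F -> A \subset F) ->
  exists b e, [/\ e \in ground M, e \notin F, three_connected (removal M b e) &
                  has_minor (removal M b e) N].
Proof.
move=> hM h3 hT th2 hMN hl hc sGF hF clF.
have hE := tangle_card_ground hM hT th2.
have nG e : e \notin F -> e \notin ground N by apply: contra; apply: (subsetP sGF).
pose P := [pred p : bool * T | [&& p.2 \in ground M, p.2 \notin F,
  removable M N p.1 p.2 & [forall A in Tg, ~~ sep_at M p.1 p.2 A]]].
case: (pickP P) => [[b e] /and4P[/= eE eF r /forall_inP ns]|none].
  exists b, e; split=> //; first exact: three_connected_removal hM h3 hT th2 eE ns.
  exact: has_minor_removal.
exfalso; apply: (@stuck_absurd _ M Tg th hM h3 hT th2 F (fun b e => removable M N b e)) => //.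
- by move=> e eE eF; apply: removable_or => //; apply: nG.
- move=> b S e a t eS aS ae aF; apply: (removable_tri hM hMN hl hc h3 hE t eS aS ae).
  exact: nG.
- move=> b e eE eF r; have := none (b, e); rewrite /= eE eF r /= => /negbT.
  by rewrite negb_forall_in => /exists_inP[A hA]; rewrite negbK; exists A.
Qed.

End Minors.

(** * Rank in the tangle matroid *)

Section TangleRank.
Variables (T : finType) (M : matroid T) (Tg : {set {set T}}) (th : nat).
Implicit Types X Y Z : {set T}.

Lemma tangle_rank_le X Y : Y \in Tg -> X \subset Y ->
  tangle_rank M Tg th X <= lambda M Y.
Proof.
move=> hY sXY; rewrite /tangle_rank -big_filter.
have: Y \in [seq Y <- index_enum _ | (Y \in Tg) && (X \subset Y)].
  by rewrite mem_filter hY sXY mem_index_enum.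
elim: [seq _ <- _ | _] => //= A s IH; rewrite big_cons inE geq_min.
by case/predU1P => [->|/IH ->]; rewrite ?leqnn ?orbT.
Qed.

Lemma tangle_rank_ge X k : k <= th ->
  (forall Y, Y \in Tg -> X \subset Y -> k <= lambda M Y) -> k <= tangle_rank M Tg th X.
Proof.
move=> kth h; rewrite /tangle_rank; elim/big_ind: _ => //.
  by move=> a b ha hb; rewrite leq_min ha.
by move=> Y /andP[hY sXY]; apply: h.
Qed.

Lemma tangle_rank_attained X : tangle_rank M Tg th X < th ->
  exists2 Y, Y \in Tg /\ X \subset Y & lambda M Y = tangle_rank M Tg th X.
Proof.
move=> lt; pose P Y := [&& Y \in Tg, X \subset Y & lambda M Y <= tangle_rank M Tg th X].
case: (pickP P).
  move=> Y /and3P[hY sXY le]; exists Y => //; apply/eqP.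
  by rewrite eqn_leq le tangle_rank_le.
(* If no member attained the minimum, all values including the default th would exceed it. *)
move=> none; have : (tangle_rank M Tg th X).+1 <= tangle_rank M Tg th X; last by rewrite ltnn.
apply: tangle_rank_ge => // Y hY sXY; rewrite ltnNge; apply/negP => le.
by have := none Y; rewrite /P hY sXY le.
Qed.

End TangleRank.

(** * The tangle induced on a minor *)

Section MinorTangle.
Variables (T : finType) (M : matroid T) (C D : {set T}).
Hypotheses (hM : matroid_axioms M) (sC : C \subset ground M) (sD : D \subset ground M)
  (dCD : C \subset ~: D).
Local Notation E := (ground M).
Local Notation Z := (C :|: D).
Local Notation M1 := (minor_of M C D).
Implicit Types X Y : {set T}.

Lemma lambda_minorE Y : Y \subset E :\: Z ->
  lambda M1 Y + rk M C + rk M (E :\: D) =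
  rk M (Y :|: C) + rk M ((E :\: Z) :\: Y :|: C).
Proof.
move=> sY; rewrite /lambda /rank /=.
have e1 : (E :\: Z) :|: C = E :\: D by set_tac.
rewrite e1.
have s1 : Y :|: C \subset E by set_tac.
have s2 : (E :\: Z) :\: Y :|: C \subset E by set_tac.
have := rk_submod hM s1 s2.
have -> : Y :|: C :|: ((E :\: Z) :\: Y :|: C) = E :\: D by set_tac.
have -> : (Y :|: C) :&: ((E :\: Z) :\: Y :|: C) = C by set_tac.
have s3 : C \subset E :\: D by set_tac.
have := rk_mono hM s3 (subsetDl _ _).
have := rk_mono hM (subsetUr Y C) s1.
have := rk_mono hM (subsetUr ((E :\: Z) :\: Y) C) s2.
nlia.
Qed.

(** Contraction costs at most the rank of C, hence |C|, and deletion at most |D|, the most that D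
    can add to the rank of the side of [Y]. *)
Lemma lambda_minor_ge Y : Y \subset E :\: Z -> lambda M (Y :|: Z) <= lambda M1 Y + #|Z|.
Proof.
move=> sY; have := lambda_minorE sY.
have sYZ : Y :|: Z \subset E by set_tac.
have := lambdaE hM true sYZ; rewrite /rkb setIid (setIidPl sYZ) (setIidPl (subsetDl _ _)).
have e1 : Y :|: Z = (Y :|: C) :|: D by set_tac.
have s1 : Y :|: C \subset E by set_tac.
have e2 : E :\: (Y :|: Z) = (E :\: Z) :\: Y by set_tac.
have s2 : (E :\: Z) :\: Y :|: C \subset E by set_tac.
have := rk_setU hM s1 sD; rewrite -e1.
have := rk_mono hM (subsetUl ((E :\: Z) :\: Y) C) s2; rewrite -e2.
have := rk_mono hM (subsetDl E D) (subxx _); have := rk_card hM sC.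
have cZ : #|Z| = #|C| + #|D|.
  by apply/eqP; rewrite (leq_card_setU C D).2 disjoints_subset.
rewrite cZ; nlia.
Qed.

Lemma lambda_minor_le Y : Y \subset E :\: Z -> lambda M1 Y <= lambda M (Y :|: Z).
Proof.
move=> sY; have := lambda_minorE sY.
have sYZ : Y :|: Z \subset E by set_tac.
have := lambdaE hM true sYZ; rewrite /rkb setIid (setIidPl sYZ) (setIidPl (subsetDl _ _)).
have e2 : E :\: (Y :|: Z) = (E :\: Z) :\: Y by set_tac.
rewrite e2.
have s1 : (E :\: Z) :\: Y \subset E by set_tac.
have := rk_submod hM s1 sC.
have sED : E :\: D \subset E by exact: subsetDl.
have := rk_submod hM sYZ sED.
have -> : Y :|: Z :|: (E :\: D) = E by set_tac.
have -> : (Y :|: Z) :&: (E :\: D) = Y :|: C by set_tac.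
nlia.
Qed.

Variables (Tg : {set {set T}}) (th : nat).
Hypothesis hT : is_tangle M Tg th.
Hypothesis hZ : #|Z|.+1 < th.

(** The order drops by |Z| so that, by [lambda_minor_ge], small connectivity in the minor gives
    connectivity below [th] in M once Z is added. *)
Definition minor_tangle : {set {set T}} :=
  [set Y : {set T} | [&& Y \subset E :\: Z, lambda M1 Y < th - #|Z| & Y :|: Z \in Tg]].

Lemma in_minor_tangle Y : Y \in minor_tangle =
  [&& Y \subset E :\: Z, lambda M1 Y < th - #|Z| & Y :|: Z \in Tg].
Proof. by rewrite inE. Qed.

Lemma minor_tangleP : is_tangle M1 minor_tangle (th - #|Z|).
Proof.
have th1 : 1 < th by nlia.
have sZ : Z \subset E by set_tac.
have tZ : Z \in Tg by apply: (tangle_small hM hT) => //; nlia.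
have hM1 : matroid_axioms M1 by apply: matroid_axioms_minor.
split=> [X|X|X sX lX|X1 X2 X3|e].
- by rewrite in_minor_tangle => /and3P[].
- by rewrite in_minor_tangle => /and3P[].
- have sX' : X \subset E :\: Z by [].
  have sD' : (E :\: Z) :\: X \subset E :\: Z by apply: subsetDl.
  have lC : lambda M1 ((E :\: Z) :\: X) = lambda M1 X := lambdaC hM1 sX.
  have l1 := lambda_minor_ge sX'; have l2 := lambda_minor_ge sD'; rewrite lC in l2.
  have sXZ : X :|: Z \subset E by set_tac.
  have sDZ : (E :\: Z) :\: X :|: Z \subset E by set_tac.
  have lX1 : lambda M (X :|: Z) < th by nlia.
  have lX2 : lambda M ((E :\: Z) :\: X :|: Z) < th by nlia.
  rewrite !in_minor_tangle sX' sD' /= lX lC lX /=.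
  case: (tangle_orC hT sXZ lX1) => [->|h1]; first by left.
  case: (tangle_orC hT sDZ lX2) => [->|h2]; first by right.
  (* The complements of the two enlarged sides are the sides themselves, exchanged; with the small
     member Z they cover E. *)
  exfalso; apply: (tangle_cover hT h1 h2 tZ).
  by set_tac.
- rewrite !in_minor_tangle => /and3P[s1 _ h1] /and3P[s2 _ h2] /and3P[s3 _ h3].
  apply/eqP => e; apply: (tangle_cover hT h1 h2 h3).
  have eE : E = (X1 :|: X2 :|: X3) :|: Z by rewrite e /=; set_tac.
  by rewrite {1}eE; set_tac.
- rewrite /= => eE; rewrite in_minor_tangle; apply/negP => /and3P[_ _].
  have -> : (E :\: Z) :\ e :|: Z = E :\ e.
    move: eE; rewrite !inE negb_or => /andP[/andP[eC eD] eE].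
    by set_tac.
  have eE' : e \in E by move: eE; rewrite inE => /andP[].
  by case: hT => _ _ _ _ /(_ e eE') /negbTE ->.
Qed.

End MinorTangle.

Lemma exists_maxset (T : finType) (P : pred {set T}) (A : {set T}) : P A ->
  exists2 B, P B & forall B', P B' -> #|B'| <= #|B|.
Proof. by move=> PA; case: (@arg_maxnP _ A P (fun B => #|B|) PA) => B; exists B. Qed.

(** * Transport along equality of matroids *)

Section MatroidEq.
Variable T : finType.
Implicit Types (M N : matroid T) (C D X : {set T}).

Lemma matroid_eq_lambda M N X : matroid_eq M N -> X \subset ground M ->
  lambda M X = lambda N X.
Proof.
by case=> eG eR sX; rewrite /lambda /rank -eG !eR // ?subsetDl.
Qed.

Lemma matroid_eq_three_connected M N : matroid_eq M N -> three_connected M ->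
  three_connected N.
Proof.
move=> eMN h X k sX hk c1 c2; case: (eMN) => eG _.
rewrite -(matroid_eq_lambda eMN) -?eG //; rewrite -?eG // in sX c2 *.
by apply: h; rewrite ?eG // -eG.
Qed.

Lemma matroid_eq_has_minor M M' N : matroid_eq M M' -> has_minor M N -> has_minor M' N.
Proof.
case=> eG eR [C [D [sC sD dCD [eN rN]]]]; exists C, D; rewrite -eG; split=> //.
split=> [|X sX]; first by rewrite eN /= eG.
have sX' : X :|: C \subset ground M.
  rewrite subUset sC andbT; apply: subset_trans sX _; rewrite eN; exact: subsetDl.
by rewrite rN //= !eR.
Qed.

Lemma matroid_eq_minor0 M : matroid_axioms M -> matroid_eq M (minor_of M set0 set0).
Proof. by move=> hM; split=> [|X sX] /=; rewrite !setU0 ?setD0 // rk0 // subn0. Qed.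

(** For contraction the nested truncated subtractions telescope by monotonicity, which is available
    only inside the ground set. *)
Lemma matroid_eq_removal M C D b e : matroid_axioms M -> C \subset ground M ->
  e \in ground M ->
  matroid_eq (removal (minor_of M C D) b e)
    (minor_of M (if b then e |: C else C) (if b then D else e |: D)).
Proof.
move=> hM sC eE; split=> [|X].
  by rewrite ground_removal; case: b => /=; set_tac.
rewrite ground_removal /= => sX; case: b => /=; last first.
  by rewrite setU0 set0U subnn subn0.
have sX' : X \subset ground M by set_tac.
have -> : X :|: [set e] :|: C = X :|: (e |: C) by rewrite setUA.
have s1 : e |: C \subset ground M by set_tac.
have s2 : X :|: (e |: C) \subset ground M by set_tac.
have := rk_mono hM (subsetUr X (e |: C)) s2.
by have := rk_mono hM (subsetU1 e C) s1; nlia.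
Qed.

End MatroidEq.

(** * Building the pair (C, D) *)

Section Main.
Variables (T : finType) (M N : matroid T) (Tg : {set {set T}}) (th : nat).
Hypotheses (hM : matroid_axioms M) (h3 : three_connected M) (hT : is_tangle M Tg th).
Hypotheses (hMN : has_minor M N) (hl : no_loops N) (hc : no_coloops N).
Local Notation E := (ground M).
Local Notation G := (ground N).
Local Notation t := (tangle_rank M Tg th G).

Definition good_pair (C D : {set T}) :=
  [/\ C \subset E :\: G, D \subset E :\: G & C \subset ~: D] /\
  [/\ three_connected (minor_of M C D), has_minor (minor_of M C D) N &
      tangle_rank M Tg th (G :|: C :|: D) = t + #|C :|: D|].

(** [F] is a largest member containing [X] of minimum connectivity. Its intersection with [Y] still
    contains [X], so it has at least that connectivity; by submodularity the union has at most that
    much, and maximality puts [Y] inside [F]. *)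
Lemma tangle_closure (X : {set T}) : tangle_rank M Tg th X < th ->
  exists F, [/\ F \in Tg, X \subset F, lambda M F = tangle_rank M Tg th X &
    forall Y, Y \in Tg -> X \subset Y -> lambda M Y <= tangle_rank M Tg th X -> Y \subset F].
Proof.
move=> lt; set R := tangle_rank M Tg th X in lt *.
have [Y0 [hY0 sY0] lY0] := tangle_rank_attained lt.
pose P (B : {set T}) := [&& B \in Tg, X \subset B & lambda M B <= R].
have [F /and3P[hF sF lF] mF] : exists2 B, P B & forall B', P B' -> #|B'| <= #|B|.
  by apply: (@exists_maxset _ P Y0); rewrite /P hY0 sY0 lY0 leqnn.
exists F; split=> //.
  by apply/eqP; rewrite eqn_leq lF tangle_rank_le.
move=> Y hY sY lY.
have lI : R <= lambda M (F :&: Y).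
  case: (ltnP (lambda M (F :&: Y)) th) => h; last by nlia.
  apply: tangle_rank_le; last by rewrite subsetI sF.
  exact: (tangle_subset hT (subsetIl F Y) hF h).
have := lambda_submod hM (tangle_sub hT hF) (tangle_sub hT hY) => lU.
have lU' : lambda M (F :|: Y) <= R by nlia.
have hU : F :|: Y \in Tg by apply: (tangle_setU hT hF hY); nlia.
have PU : P (F :|: Y) by rewrite /P hU lU' (subset_trans sF (subsetUl _ _)).
have eF : F = F :|: Y by apply/eqP; rewrite eqEcard subsetUl mF.
by rewrite eF subsetUr.
Qed.

(** The bound keeps the connectivity t + |Z| of the closure below the order [th] - |Z| of the
    induced tangle, and that order above 2. *)
Lemma good_pair_step C D : good_pair C D -> 2 * #|C :|: D| + t + 3 <= th ->
  exists C' D', good_pair C' D' /\ #|C' :|: D'| = #|C :|: D|.+1.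
Proof.
move=> [[sCG sDG dCD] [h31 hmN rt]] hth.
have sC : C \subset E by apply: subset_trans sCG (subsetDl _ _).
have sD : D \subset E by apply: subset_trans sDG (subsetDl _ _).
have sG := has_minor_sub hMN.
set Z := C :|: D in rt hth *; set M1 := minor_of M C D in h31 hmN *.
set X0 := G :|: C :|: D in rt *.
have hM1 : matroid_axioms M1 by apply: matroid_axioms_minor.
have hZ : #|Z|.+1 < th by nlia.
have hT1 := minor_tangleP hM sC sD dCD hT hZ.
set T1 := minor_tangle M C D Tg th in hT1.
have lt : tangle_rank M Tg th X0 < th by nlia.
have [F [hF sXF lF clF]] := tangle_closure lt; rewrite rt in lF clF.
have sF := tangle_sub hT hF.
have sZF : Z \subset F by apply: subset_trans sXF; rewrite /Z /X0; set_tac.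
have sF0 : F :\: Z \subset E :\: Z by apply: setSD.
have eF0 : F :\: Z :|: Z = F by clearbody Z; set_tac.
have l0 := lambda_minor_le hM sC sD dCD sF0; rewrite -/Z eF0 lF -/M1 in l0.
have hF0 : F :\: Z \in T1.
  by rewrite in_minor_tangle -/Z -/M1 sF0 eF0 hF andbT; apply/andP; split=> //; nlia.
(* F - Z need not be closed for the induced tangle, so it is enlarged to F1; elements of the minor
   outside F1 are still outside F. *)
pose P (B : {set T}) := [&& B \in T1, F :\: Z \subset B & lambda M1 B <= lambda M1 (F :\: Z)].
have [F1 /and3P[hF1 sF1 lF1] mF1] : exists2 B, P B & forall B', P B' -> #|B'| <= #|B|.
  by apply: (@exists_maxset _ P (F :\: Z)); rewrite /P hF0 subxx leqnn.
have clF1 A : A \in T1 -> lambda M1 (A :|: F1) <= lambda M1 F1 -> A \subset F1.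
  move=> hA lA; have hU : A :|: F1 \in T1.
    exact: (tangle_setU hT1 hA hF1 (leq_ltn_trans lA (tangle_lt hT1 hF1))).
  have PU : P (A :|: F1).
    by rewrite /P hU (subset_trans sF1 (subsetUr _ _)) (leq_trans lA lF1).
  have -> : F1 = A :|: F1 by apply/eqP; rewrite eqEcard subsetUr mF1.
  exact: subsetUl.
have sGF1 : G \subset F1.
  apply: subset_trans sF1; apply/subsetP => z zG; rewrite inE.
  rewrite (subsetP sXF) ?andbT; last by rewrite /X0 !inE zG.
  rewrite /Z inE negb_or; apply/andP; split.
    by apply/negP => /(subsetP sCG); rewrite inE zG.
  by apply/negP => /(subsetP sDG); rewrite inE zG.
have th3 : 2 < th - #|Z| by nlia.
have [b [e [eE1 eF1 h3e hmNe]]] := removable_exists hM1 h31 hT1 th3 hmN hl hc sGF1 hF1 clF1.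
have /setDP[eE eZ] : e \in E :\: Z by [].
have eF : e \notin F by apply: contra eF1 => eF; apply: (subsetP sF1); rewrite inE eZ.
have eG : e \notin G by apply: contra eF1 => /(subsetP sGF1).
have eqM := matroid_eq_removal D b hM sC eE.
have /norP[eC eD] : ~~ ((e \in C) || (e \in D)) by rewrite -in_setU.
exists (if b then e |: C else C), (if b then D else e |: D).
set C' := if b then _ else _; set D' := if b then _ else _.
have eZ' : C' :|: D' = e |: Z by rewrite /C' /D' /Z; case: (b); set_tac.
have cZ' : #|C' :|: D'| = #|Z|.+1 by rewrite eZ' cardsU1 eZ.
split=> //; split.
  by rewrite /C' /D'; case: (b); split; set_tac.
split.
- exact: (matroid_eq_three_connected eqM h3e).
- exact: (matroid_eq_has_minor eqM hmNe).
have -> : G :|: C' :|: D' = e |: X0 by rewrite -setUA eZ' /X0 /Z; set_tac.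
(* The member F + e bounds the rank from above. For the lower bound, a member containing X0 + e of
   connectivity at most t + |Z| would lie in F, but e does not. *)
rewrite cZ'; apply/eqP; rewrite eqn_leq; apply/andP; split.
  have s1 : [set e] \subset E by rewrite sub1set.
  have := lambda_submod hM s1 sF; have := lambda_leq_card hM s1; rewrite cards1 lF => h1 h2.
  have hFe : e |: F \in Tg by apply: (tangle_setU1 hM hT) => //; nlia.
  by have := @tangle_rank_le _ M Tg th (e |: X0) _ hFe (setUS _ sXF); nlia.
apply: tangle_rank_ge => [|Y hY sY]; first by nlia.
rewrite addnS ltnNge; apply/negP => lY; move/negP: eF; apply.
apply: (subsetP (clF Y hY _ lY)); last by apply: (subsetP sY); rewrite !inE eqxx.
by apply: subset_trans (subsetU1 _ _) sY.
Qed.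

Lemma good_pair_exists n : n = 0 \/ 2 * n + t + 1 <= th ->
  exists C D, good_pair C D /\ #|C :|: D| = n.
Proof.
elim: n => [_|n IH [//|hn]].
  exists set0, set0; rewrite setU0 cards0; split=> //; split.
    by rewrite !sub0set.
  have eqM := matroid_eq_minor0 hM; rewrite !setU0 cards0 addn0; split=> //.
    exact: (matroid_eq_three_connected eqM h3).
  exact: (matroid_eq_has_minor eqM hMN).
have [|C [D [gp cn]]] := IH; first by right; nlia.
have [|C' [D' [gp' cn']]] := good_pair_step gp; first by rewrite cn; nlia.
by exists C', D'; rewrite cn' cn.
Qed.

End Main.

Theorem theorem3p2 (T : finType) (s : int) (M : matroid T)
    (Tg : {set {set T}}) (theta : nat) (N : matroid T) :
  matroid_axioms M -> three_connected M ->
  is_tangle M Tg theta -> 6 <= theta ->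
  has_minor M N -> no_loops N -> no_coloops N ->
  let t := tangle_rank M Tg theta (ground N) in
  (2 * s + t%:Z + 1 <= theta%:Z)%R ->
  exists C D : {set T},
    C \subset ground M :\: ground N /\ D \subset ground M :\: ground N /\
    [disjoint C & D] /\
    three_connected (minor_of M C D) /\ has_minor (minor_of M C D) N /\
    tangle_rank M Tg theta (ground N :|: C :|: D) = t + #|C :|: D| /\
    (s <= (#|C :|: D|)%:Z)%R.
Proof.
move=> hM h3 hT _ hMN hl hc t hs.
(* A negative s gives no bound on t, so the empty pair is used there, through the alternative n =
   0. *)
have [n hn sn] : exists2 n : nat, n = 0 \/ 2 * n + t + 1 <= theta & (s <= n%:Z)%R.
  case: s hs => n hs; last by exists 0; [left | lia].
  by exists n => //; right; lia.
have [C [D [[[sC sD dCD] [h31 hmN rt]] cn]]] := good_pair_exists hM h3 hT hMN hl hc hn.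
by exists C, D; rewrite disjoints_subset cn -[in RHS]cn.
Qed.
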